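(* Let $\mathcal H$ be a finite-dimensional Hilbert space and $\varrho,\sigma$ density operators on $\mathcal H$. For every $\alpha\in(0,1)$, \[ \tfrac12 D_\alpha(\varrho\|\sigma)\le \overline{D}_\alpha^{\mathrm{test}}(\varrho\|\sigma)\le D_\alpha(\varrho\|\sigma). \] Moreover, the following are equivalent: (1) the second inequality is strict for every $\alpha\in(0,1)$; (2) the second inequality is strict for some $\alpha\in(0,1)$; (3) $\frac1n D_\alpha^{\mathrm{test}}(\varrho^{\otimes n}\|\sigma^{\otimes n})<D_\alpha(\varrho\|\sigma)$ for some $\alpha\in(0,1)$ and some $n\in\mathbb N$; (4) both $\beta\mapsto D_\beta(\varrho\|\sigma)$ and $\beta\mapsto D_\beta(\sigma\|\varrho)$ are strictly increasing on $(0,1)$.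
   Context: For a PSD operator $A=\sum_a aP_a$ (spectral decomposition) and $x\in\mathbb R$, $A^x:=\sum_{a>0}a^xP_a$. For probability vectors $p,q$ on a finite set and $\alpha\in(0,1)$, $D_\alpha(p\|q)=\frac{1}{\alpha-1}\log\sum_\omega p(\omega)^\alpha q(\omega)^{1-\alpha}$. A test is an operator $0\le T\le I$; $\mathcal T(X):=(\operatorname{Tr}XT,\operatorname{Tr}X(I-T))$. $D_\alpha^{\mathrm{test}}(\varrho\|\sigma):=\max_{0\le T\le I}D_\alpha(\mathcal T(\varrho)\|\mathcal T(\sigma))$ and $\overline{D}_\alpha^{\mathrm{test}}(\varrho\|\sigma):=\limsup_{n\to\infty}\frac1n D_\alpha^{\mathrm{test}}(\varrho^{\otimes n}\|\sigma^{\otimes n})$. The Petz-type Rényi divergence for $\alpha\in(0,1)$ is $D_\alpha(\varrho\|\sigma)=\frac{1}{\alpha-1}\log\operatorname{Tr}\varrho^\alpha\sigma^{1-\alpha}$ ($=+\infty$ if the trace is $0$). *)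

(* Defs.v *)
From HB Require Import structures.
From mathcomp Require Import all_boot all_order all_algebra.
From mathcomp Require Import sesquilinear spectral.
From mathcomp Require Import all_classical all_reals.
From mathcomp Require Import ereal topology normedtype sequences exp.
From mathcomp Require Import complex.
From mathcomp Require mxtens.

Set Implicit Arguments.
Unset Strict Implicit.
Unset Printing Implicit Defensive.

Import Order.TTheory GRing.Theory Num.Theory.
Local Open Scope ring_scope.

Notation C R := (complex.complex R).

Section Defs.
Variable R : realType.

Definition cR (x : R) : C R := complex.Complex x 0.

Definition psdmx (d : nat) (A : 'M[C R]_d) : Prop :=
  A \is hermsymmx /\
  forall v : 'rV[C R]_d, 0 <= (v *m A *m (map_mx Num.conj v)^T) 0 0.

Definition density (d : nat) (rho : 'M[C R]_d) : Prop :=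
  psdmx rho /\ \tr rho = 1.

Definition is_test (d : nat) (T : 'M[C R]_d) : Prop :=
  psdmx T /\ psdmx (1%:M - T).

Definition eigpow (x : R) (a : C R) : C R :=
  if 0 < a then cR (powR (complex.Re a) x) else 0.

(* A^x := sum_{a>0} a^x P_a, computed from the spectral decomposition
   A = P^-1 diag(a) P (P unitary) of the normal matrix A *)
Definition mxpow (d : nat) (A : 'M[C R]_d) (x : R) : 'M[C R]_d :=
  invmx (spectralmx A) *m diag_mx (map_mx (eigpow x) (spectral_diag A))
        *m spectralmx A.

Definition renyi_of (alpha s : R) : \bar R :=
  if 0 < s then ((ln s) / (alpha - 1))%:E else +oo%E.

Definition classD (k : nat) (alpha : R) (p q : 'I_k -> R) : \bar R :=
  renyi_of alpha (\sum_(w < k) powR (p w) alpha * powR (q w) (1 - alpha)).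

(* real part of a trace (traces below are real) *)
Definition rtr (d : nat) (A : 'M[C R]_d) : R := complex.Re (\tr A).

Definition testdist (d : nat) (T X : 'M[C R]_d) : 'I_2 -> R :=
  fun w => if w == ord0 then rtr (X *m T) else rtr (X *m (1%:M - T)).

(* test-measured Renyi divergence: max over tests (the sup is attained) *)
Definition Dtest (d : nat) (alpha : R) (rho sigma : 'M[C R]_d) : \bar R :=
  ereal_sup [set classD alpha (testdist T rho) (testdist T sigma)
            | T in [set T : 'M[C R]_d | is_test T]].

Definition tpow (d : nat) (A : 'M[C R]_d) (n : nat) : 'M[C R]_(d ^ n) :=
  mxtens.ntensmx A n.

Definition Dtest_reg (d : nat) (alpha : R) (rho sigma : 'M[C R]_d) : \bar R :=
  limn_esup (fun n : nat =>
    ((n%:R)^-1)%:E * Dtest alpha (tpow rho n) (tpow sigma n))%E.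

Definition DPetz (d : nat) (alpha : R) (rho sigma : 'M[C R]_d) : \bar R :=
  renyi_of alpha (rtr (mxpow rho alpha *m mxpow sigma (1 - alpha))).

End Defs.

(* Main.v *)
Require Import Defs.
From HB Require Import structures.
From mathcomp Require Import all_boot all_order all_algebra.
From mathcomp Require Import sesquilinear spectral.
From mathcomp Require Import all_classical all_reals.
From mathcomp Require Import ereal topology normedtype sequences exp.
From mathcomp Require Import complex.
From mathcomp Require mxtens.
From mathcomp Require Import ring lra.

Set Implicit Arguments.
Unset Strict Implicit.

Import Order.TTheory GRing.Theory Num.Theory.
Import numFieldNormedType.Exports.
Local Open Scope ring_scope.
Local Open Scope classical_set_scope.

(** Write [Q_s = Tr rho^s sigma^(1-s)], so that [D_s = log Q_s / (s - 1)].

    Lower bound: Audenaert's inequality for [rho] and [c sigma], with a suitable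
    [c], yields a test with errors [e1], [e2] such that [e1^al] and [e2^(1-al)]
    are at most [Q_al^(1/2)]; on [n] copies the resulting factor [2] disappears in
    the limit.

    Upper bound: by Nussbaum and Szkola a test on [n] copies is, up to a factor
    [2], no better than a classical test between the measures
    [p_ij = a_i |<e_i|f_j>|^2] and [q_ij = b_j |<e_i|f_j>|^2].  Under the tilted
    measure [p^al q^(1-al)] the log-likelihood ratio concentrates at [n mu], where
    [mu] is the derivative of [psi = log Q] at [al].  Hence [e1^al] and
    [e2^(1-al)] cannot both decay faster than at the exponents
    [al (psi + (1 - al) mu)] and [(1 - al) (psi - al mu)].
    Both are at least [psi], because the tangent of the convex function [psi] at
    [al] is nonpositive at [0] and at [1].

    Equivalence: if both divergences increase strictly, these two inequalities
    are strict for every [al].  Otherwise [psi] is affine and vanishes at [0] or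
    at [1], and the support projection of [sigma^(tensor n)] or
    [rho^(tensor n)] is a test that attains [D_al] for every [n]. *)

(** * Powers as limits of positive combinations of [x / (x + t)] *)

(** The real form of [eigpow]. The value [0] at nonpositive [a], also for [x = 0], turns [mxpow A 0]
    into the support projection of a positive [A]. *)
Definition pw {R : realType} (x a : R) : R := if 0 < a then powR a x else 0.

Lemma pw_ge0 (R : realType) (x a : R) : 0 <= pw x a.
Proof. by rewrite /pw; case: ifP => // _; exact: powR_ge0. Qed.

Section PowerAsGridSum.
Variables (R : realType) (d s : R).
Hypotheses (d_gt0 : 0 < d) (s_gt0 : 0 < s) (s_lt1 : s < 1).

(** With [t = expR u], the integral of [t^(s-1) x / (x + t)] over the positive half-line is a
    constant times [x^s] and becomes that of [expR (u s) x / (x + expR u)]. Up to the factor [d],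
    these are its Riemann terms at [u = d r]; [gpair] joins [k] with [-(k+1)], so that the series
    runs over all integers. *)
Definition gterm (r x : R) : R := expR (d * r * s) * (x / (x + expR (d * r))).

Definition gpair (x : R) (k : nat) : R := gterm k%:R x + gterm (- k.+1%:R) x.

Definition gsum (x : R) : R := limn (series (gpair x)).

Lemma gterm_ge0 r x : 0 <= x -> 0 <= gterm r x.
Proof.
by move=> x0; rewrite /gterm mulr_ge0 ?expR_ge0 // divr_ge0 ?addr_ge0 ?expR_ge0.
Qed.

Lemma gterm_gt0 r x : 0 < x -> 0 < gterm r x.
Proof.
by move=> x0; rewrite /gterm mulr_gt0 ?expR_gt0 // divr_gt0 ?addr_gt0 ?expR_gt0.
Qed.

Lemma gterm_le r x y : 0 <= x -> x <= y -> gterm r x <= gterm r y.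
Proof.
move=> x0 xy; have e0 := expR_gt0 (d * r).
rewrite /gterm ler_wpM2l ?expR_ge0 // ler_pdivrMr; last by lra.
by rewrite mulrAC ler_pdivlMr; nra.
Qed.

Lemma gterm_shift r x : 0 <= x ->
  gterm r (expR d * x) = expR (d * s) * gterm (r - 1) x.
Proof.
move=> x0; rewrite /gterm [RHS]mulrA -expRD; have := expR_gt0 d => ed.
have -> : d * s + d * (r - 1) * s = d * r * s by ring.
congr (_ * _).
have -> : d * r = d + d * (r - 1) by ring.
rewrite expRD -mulrDr; have := expR_gt0 (d * (r - 1)) => er.
by field; rewrite ?gt_eqF //; apply: ltr_wpDl.
Qed.

Lemma gpair_ge0 x k : 0 <= x -> 0 <= gpair x k.
Proof. by move=> x0; rewrite addr_ge0 ?gterm_ge0. Qed.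

(** The bounds [x / (x + t) <= x / t] for large [t] and [x / (x + t) <= 1] for small [t] leave two
    geometric series, whose ratios are below [1] because [0 < s < 1]. *)
Lemma gsum_cvg x : 0 <= x -> cvgn (series (gpair x)).
Proof.
move=> x0.
pose q := expR (- (d * (1 - s))); pose q' := expR (- (d * s)).
have q1 : `|q| < 1.
  by rewrite ger0_norm ?expR_ge0 // expR_lt1 oppr_lt0 mulr_gt0 // subr_gt0.
have q'1 : `|q'| < 1 by rewrite ger0_norm ?expR_ge0 // expR_lt1 oppr_lt0 mulr_gt0.
apply: (@series_le_cvg _ _ (geometric x q + geometric 1 q')).
- by move=> k; exact: gpair_ge0.
- by move=> k; rewrite addr_ge0 // ?mulr_ge0 ?exprn_ge0 ?expR_ge0.
- move=> k; apply: lerD.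
    rewrite /gterm /= /q -expRM_natl.
    have e0 := expR_gt0 (d * k%:R).
    rewrite (_ : _ * - _ = d * k%:R * s - d * k%:R); last by ring.
    rewrite expRD expRN mulrCA ler_wpM2l ?expR_ge0 // ler_wpM2l //.
    by rewrite lef_pV2 ?posrE ?lerDr // ltr_wpDl.
  rewrite /gterm /= mul1r /q' -expRM_natl.
  have e0 := expR_gt0 (d * - k.+1%:R).
  apply: (@le_trans _ _ (expR (d * - k.+1%:R * s))).
    rewrite ler_piMr ?expR_ge0 // ler_pdivrMr ?mul1r ?lerDl ?expR_ge0 //.
    by rewrite ltr_wpDl.
  rewrite ler_expR -natr1; have := mulr_gt0 d_gt0 s_gt0; nra.
- by apply: is_cvg_seriesD; exact: is_cvg_geometric_series.
Qed.

(** The partial sum runs over the grid indices from [-N] to [N-1]. Shifting by one gains the index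
    [-N-1] and loses [N-1]; both boundary terms vanish in the limit. *)
Lemma gsum_partial_shift x N : 0 <= x ->
  series (gpair (expR d * x)) N =
  expR (d * s) * (series (gpair x) N + gterm (- N%:R - 1) x - gterm (N%:R - 1) x).
Proof.
move=> x0; elim: N => [|N IH].
  by rewrite /series /= !big_geq // oppr0 add0r addrN mulr0.
rewrite !seriesSr IH /gpair !gterm_shift //.
have -> : N.+1%:R - 1 = N%:R :> R by rewrite -natr1 addrK.
have -> : - N%:R - 1 = - N.+1%:R :> R by rewrite -natr1 opprD.
ring.
Qed.

Lemma gsum_shift x : 0 <= x -> gsum (expR d * x) = expR (d * s) * gsum x.
Proof.
move=> x0; have cx := gsum_cvg x0.
have /cvg_series_cvg_0 p0 := cx.
have t0 : (fun N : nat => gterm (- N%:R - 1) x) @ \oo --> (0 : R).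
  apply: (squeeze_cvgr _ (cvg_cst 0) p0); apply: nearW => N.
  rewrite gterm_ge0 // /gpair (_ : - N%:R - 1 = - N.+1%:R :> R) ?lerDr ?gterm_ge0 //.
  by rewrite -natr1 opprD.
have t1 : (fun N : nat => gterm (N%:R - 1) x) @ \oo --> (0 : R).
  rewrite -cvg_shiftS /=.
  apply: (squeeze_cvgr _ (cvg_cst 0) p0); apply: nearW => N.
  by rewrite gterm_ge0 // /gpair -natr1 addrK lerDl gterm_ge0.
apply: cvg_lim => //.
rewrite (_ : series _ = fun N => expR (d * s) *
  (series (gpair x) N + gterm (- N%:R - 1) x - gterm (N%:R - 1) x)); last first.
  by apply/funext => N; exact: gsum_partial_shift.
apply: cvgMl_tmp; rewrite -[X in _ --> X]addr0 -[X in _ --> X]subr0.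
by apply: cvgB => //; apply: cvgD.
Qed.

Lemma gsum_shiftn n x : 0 <= x ->
  gsum (expR d ^+ n * x) = expR (d * s) ^+ n * gsum x.
Proof.
move=> x0; elim: n => [|n IH]; first by rewrite !expr0 !mul1r.
by rewrite !exprS -mulrA gsum_shift ?IH ?mulrA // mulr_ge0 ?exprn_ge0 ?expR_ge0.
Qed.

Lemma gsum_le x y : 0 <= x -> x <= y -> gsum x <= gsum y.
Proof.
move=> x0 xy; apply: ler_lim; [exact: gsum_cvg|exact/gsum_cvg/(le_trans x0)|].
apply: nearW => N; apply: ler_sum => k _.
by apply: lerD; exact: gterm_le.
Qed.

Lemma gsum1_gt0 : 0 < gsum 1.
Proof.
apply: (@lt_le_trans _ _ (series (gpair 1) 1)).
  by rewrite /series /= big_nat1 addr_gt0 ?gterm_gt0.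
apply: nondecreasing_cvgn_le; last exact: gsum_cvg.
by apply: nondecreasing_series => k _ _; exact: gpair_ge0.
Qed.

Lemma gsum0 : gsum 0 = 0.
Proof.
apply: cvg_lim => //; rewrite (_ : series _ = cst 0); first exact: cvg_cst.
apply/funext => N; rewrite /series /= big1 // => k _.
by rewrite /gpair /gterm !mul0r !mulr0 addr0.
Qed.

(** Both [gsum] and [pw s] gain the factor [expR (d * s)] when [x] is multiplied by [expR d]. It is
    therefore enough to treat [x] in [[1, expR d]], where monotonicity bounds the variation of each
    by that same factor. *)
Lemma gsum_approx x : 0 <= x ->
  expR (- (d * s)) * gsum 1 * pw s x <= gsum x <= expR (d * s) * gsum 1 * pw s x.
Proof.
rewrite le_eqVlt => /orP[/eqP <-|x0].
  by rewrite /pw ltxx !mulr0 gsum0 lexx.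
rewrite /pw x0.
have G1 := gsum1_gt0.
have shiftP n z : 0 < z ->
    (expR (- (d * s)) * gsum 1 * powR (expR d ^+ n * z) s <= gsum (expR d ^+ n * z)
      <= expR (d * s) * gsum 1 * powR (expR d ^+ n * z) s) =
    (expR (- (d * s)) * gsum 1 * powR z s <= gsum z
      <= expR (d * s) * gsum 1 * powR z s).
  move=> z0; rewrite gsum_shiftn ?(ltW z0) // powRM ?exprn_ge0 ?expR_ge0 ?(ltW z0) //.
  have -> : powR (expR d ^+ n) s = expR (d * s) ^+ n.
    by rewrite -expRM_natl -expRM -expRM_natl mulrA.
  have e0 : 0 < expR (d * s) ^+ n by rewrite exprn_gt0 ?expR_gt0.
  by rewrite ![_ * gsum 1 * (_ * _)]mulrCA !ler_pM2l.
have base z : 1 <= z -> z <= expR d ->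
    expR (- (d * s)) * gsum 1 * powR z s <= gsum z
      <= expR (d * s) * gsum 1 * powR z s.
  move=> z1 zd; have z0 : 0 <= z by apply: le_trans z1.
  have p1 : powR 1 s <= powR z s by rewrite ge0_ler_powR ?nnegrE ?(ltW s_gt0).
  rewrite powR1 in p1.
  have p2 : powR z s <= expR (d * s).
    by rewrite expRM ge0_ler_powR ?nnegrE ?expR_ge0 ?(ltW s_gt0).
  apply/andP; split.
    apply: (@le_trans _ _ (gsum 1)); last exact: gsum_le.
    rewrite mulrAC expRN ler_piMl ?(ltW G1) // mulrC ler_pdivrMr ?expR_gt0 //.
    by rewrite mul1r.
  apply: (@le_trans _ _ (gsum (expR d * 1))).
    by apply: gsum_le => //; rewrite mulr1.
  rewrite gsum_shift // ler_peMr // mulr_ge0 ?expR_ge0 //; exact: ltW.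
have big z : 1 <= z ->
    expR (- (d * s)) * gsum 1 * powR z s <= gsum z
      <= expR (d * s) * gsum 1 * powR z s.
  move=> z1; have z0 : 0 < z by apply: lt_le_trans z1.
  pose n := Num.truncn (ln z / d).
  have /andP[n1 n2] : n%:R <= ln z / d < n.+1%:R.
    by rewrite truncn_itv // divr_ge0 ?ln_ge0 ?(ltW d_gt0).
  have zE : z = expR d ^+ n * (expR (ln z - n%:R * d)).
    by rewrite -expRM_natl -expRD addrC subrK lnK.
  rewrite zE shiftP ?expR_gt0 //; apply: base.
    by rewrite -[leLHS]expR0 ler_expR subr_ge0 -ler_pdivlMr.
  by rewrite ler_expR lerBlDr -{1}(mul1r d) -mulrDl nat1r -ler_pdivrMr ?ltW.
pose n := Num.bound (- ln x / d).
rewrite -(shiftP n) //; apply: big.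
rewrite -[x in _ * x]lnK // -expRM_natl -expRD -[leLHS]expR0 ler_expR.
rewrite -lerBlDr sub0r -ler_pdivrMr //.
have [l0|l0] := leP 0 (- ln x / d); first exact/ltW/archi_boundP.
exact/(le_trans (ltW l0)).
Qed.

(** The hypothesis at the grid points [t], summed with the weights of [gterm], compares the [gsum]
    values in the limit; each side of [gsum_approx] then costs one factor [expR (d * s)]. *)
Lemma pw_approx_le (I : finType) (x y w z : I -> R) :
  (forall i, 0 <= x i) -> (forall i, 0 <= y i) ->
  (forall i, 0 <= w i) -> (forall i, 0 <= z i) ->
  (forall t, 0 < t ->
    \sum_i w i * (x i / (x i + t)) <= \sum_i z i * (y i / (y i + t))) ->
  \sum_i w i * pw s (x i) <= expR (2 * d * s) * \sum_i z i * pw s (y i).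
Proof.
move=> x0 y0 w0 z0 H.
have limE (u v : I -> R) : (forall i, 0 <= u i) ->
    (fun N => \sum_i v i * series (gpair (u i)) N) @ \oo -->
    \sum_i v i * gsum (u i).
  move=> u0; apply: cvg_big => [|i _]; first exact: add_continuous.
  apply: cvgMl_tmp; exact: gsum_cvg.
have K : \sum_i w i * gsum (x i) <= \sum_i z i * gsum (y i).
  rewrite -(cvg_lim _ (limE x w x0)) // -(cvg_lim _ (limE y z y0)) //.
  apply: ler_lim; [exact/cvgP/limE|exact/cvgP/limE|apply: nearW => N].
  have E (u v : I -> R) : \sum_i v i * series (gpair (u i)) N =
      \sum_(0 <= k < N) (expR (d * k%:R * s) *
         \sum_i v i * (u i / (u i + expR (d * k%:R))) +
       expR (d * - k.+1%:R * s) *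
         \sum_i v i * (u i / (u i + expR (d * - k.+1%:R)))).
    rewrite /series /=.
    under eq_bigr do rewrite mulr_sumr.
    rewrite exchange_big /=; apply: eq_bigr => k _.
    rewrite !mulr_sumr -big_split /=; apply: eq_bigr => i _.
    by rewrite /gpair /gterm mulrDr !(mulrCA (v i)).
  rewrite !E; apply: ler_sum => k _.
  by apply: lerD; rewrite ler_wpM2l ?expR_ge0 // H ?expR_gt0.
have G1 := gsum1_gt0.
rewrite (_ : 2 * d * s = d * s + d * s); last by ring.
rewrite expRD -mulrA -ler_pdivrMl ?expR_gt0 // -expRN -(ler_pM2l G1).
apply: le_trans (le_trans K _).
  rewrite mulrA mulr_sumr; apply: ler_sum => i _.
  rewrite mulrCA ler_wpM2l // (mulrC (gsum 1)).
  by have /andP[] := gsum_approx (x0 i).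
rewrite mulrA mulr_sumr; apply: ler_sum => i _.
rewrite [leRHS]mulrCA ler_wpM2l // (mulrC (gsum 1)).
by have /andP[] := gsum_approx (y0 i).
Qed.
End PowerAsGridSum.

(* [x `^ s] is, up to a factor tending to [1] with the mesh [d] of a geometric
   grid of values [t], a positive combination of the functions [x / (x + t)]. *)
Lemma pw_sum_le (R : realType) (s : R) (I : finType) (x y w z : I -> R) :
  0 < s -> s < 1 ->
  (forall i, 0 <= x i) -> (forall i, 0 <= y i) ->
  (forall i, 0 <= w i) -> (forall i, 0 <= z i) ->
  (forall t, 0 < t ->
    \sum_i w i * (x i / (x i + t)) <= \sum_i z i * (y i / (y i + t))) ->
  \sum_i w i * pw s (x i) <= \sum_i z i * pw s (y i).
Proof.
move=> s0 s1 x0 y0 w0 z0 H.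
set A := \sum_i _; set B := \sum_i _.
have B0 : 0 <= B by apply: sumr_ge0 => i _; rewrite mulr_ge0 ?pw_ge0.
have AB d : 0 < d -> A <= expR (2 * d * s) * B.
  by move=> d0; exact: pw_approx_le.
rewrite leNgt; apply/negP => BA.
have [B0'|Bgt0] := leP B 0.
  have := AB 1 ltr01; rewrite (_ : B = 0) ?mulr0; last by apply/le_anti/andP.
  by move=> A0; have := lt_le_trans (le_lt_trans B0 BA) A0; rewrite ltxx.
have r1 : 1 < A / B by rewrite ltr_pdivlMr ?mul1r.
have l0 : 0 < ln (A / B) by rewrite ln_gt0.
(* For this mesh the factor is the square root of [A / B], too small since [A / B] exceeds [1]. *)
have := AB (ln (A / B) / (4 * s)); rewrite divr_gt0 ?mulr_gt0 // => /(_ isT).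
rewrite -ler_pdivrMr // (_ : 2 * _ * s = ln (A / B) / 2); last first.
  by field; rewrite gt_eqF.
rewrite -[X in X <= _]lnK ?posrE ?(lt_trans _ r1) // ler_expR; lra.
Qed.

(** * Diagonalized complex matrices *)

Lemma mxtrace_rot4 (K : comNzRingType) n (P Q S T V W : 'M[K]_n) :
  \tr (P *m Q *m S *m (T *m V *m W)) = \tr (Q *m (S *m T) *m V *m (W *m P)).
Proof. by rewrite -!mulmxA mxtrace_mulC !mulmxA. Qed.

(* The transition matrix [U V^*] intertwines the two diagonals, hence also their
   images under any function: the functional calculus is well defined. *)
Lemma diag_mx_intertwine (K : numClosedFieldType) n (U V : 'M[K]_n)
    (a s fa fs : 'rV[K]_n) :
  U \is unitarymx -> V \is unitarymx ->
  map_mx Num.conj U^T *m diag_mx a *m U = map_mx Num.conj V^T *m diag_mx s *m V ->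
  (forall i j, a 0 i = s 0 j -> fa 0 i = fs 0 j) ->
  map_mx Num.conj U^T *m diag_mx fa *m U = map_mx Num.conj V^T *m diag_mx fs *m V.
Proof.
move=> Uu Vu AE fE.
have UU : U *m map_mx Num.conj U^T = 1%:M by apply/unitarymxP.
have VV : V *m map_mx Num.conj V^T = 1%:M by apply/unitarymxP.
have UU' := mulmx1C UU; have VV' := mulmx1C VV.
set Uc := map_mx _ U^T in AE UU UU' *; set Vc := map_mx _ V^T in AE VV VV' *.
pose W := U *m Vc.
have WE : diag_mx a *m W = W *m diag_mx s.
  have := congr1 (fun X => U *m X *m Vc) AE.
  by rewrite /W !mulmxA UU mul1mx -!mulmxA VV mulmx1 !mulmxA.
have WfE : diag_mx fa *m W = W *m diag_mx fs.
  move: (W) WE => X XE; apply/matrixP => i j; have /matrixP/(_ i j) := XE.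
  rewrite !mul_diag_mx !mul_mx_diag !mxE => h.
  have [->|X0] := eqVneq (X i j) 0; first by rewrite mulr0 mul0r.
  rewrite mulrC; congr (_ * _); apply: fE; apply: (mulfI X0).
  by rewrite -h mulrC.
rewrite -[LHS]mulmx1 -VV' (_ : _ *m _ = Uc *m (diag_mx fa *m W) *m V); last first.
  by rewrite /W !mulmxA.
by rewrite WfE /W !mulmxA UU' mul1mx.
Qed.

Section ComplexMatrices.
Variable R : realType.
Local Open Scope sesquilinear_scope.

Local Notation Re := (@complex.Re R).
Local Notation Im := (@complex.Im R).

Lemma ReD (x y : C R) : Re (x + y) = Re x + Re y.
Proof. by case: x; case: y. Qed.

Lemma Re_sum (I : Type) (r : seq I) (P : pred I) (F : I -> C R) :
  Re (\sum_(i <- r | P i) F i) = \sum_(i <- r | P i) Re (F i).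
Proof. by apply: (big_morph Re ReD). Qed.

Lemma conjE (z : C R) : Num.conj z = Complex (Re z) (- Im z).
Proof. by case: z. Qed.

Lemma cR0 : cR (0 : R) = 0. Proof. by []. Qed.
Lemma cR1 : cR (1 : R) = 1. Proof. by []. Qed.

Lemma cRD (x y : R) : cR (x + y) = cR x + cR y.
Proof. by apply/eqP; rewrite eq_complex /= addr0 !eqxx. Qed.

Lemma cRM (x y : R) : cR (x * y) = cR x * cR y.
Proof.
by apply/eqP; rewrite eq_complex /= !mulr0 mul0r subr0 addr0 !eqxx.
Qed.

Lemma cR_sum (I : Type) (r : seq I) (P : pred I) (F : I -> R) :
  cR (\sum_(i <- r | P i) F i) = \sum_(i <- r | P i) cR (F i).
Proof. by apply: (big_morph (@cR R) cRD cR0). Qed.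

Lemma conj_cR (x : R) : Num.conj (cR x) = cR x.
Proof. by rewrite conjE /= oppr0. Qed.

Lemma Re_cRM (x : R) (z : C R) : Re (cR x * z) = x * Re z.
Proof. by case: z => a b /=; rewrite mul0r subr0. Qed.

Lemma cR_inj : injective (@cR R).
Proof. by move=> x y []. Qed.

Definition nsq (z : C R) : R := Re z ^+ 2 + Im z ^+ 2.

Lemma nsqE (z : C R) : z * Num.conj z = cR (nsq z).
Proof.
case: z => a b; rewrite conjE /nsq /=; apply/eqP; rewrite eq_complex /=.
by apply/andP; split; apply/eqP; ring.
Qed.

Lemma nsq_ge0 z : 0 <= nsq z. Proof. by rewrite addr_ge0 ?sqr_ge0. Qed.

Lemma nsq_conj z : nsq (Num.conj z) = nsq z.
Proof. by rewrite conjE /nsq /= sqrrN. Qed.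

Lemma nsq_cRM (x : R) z : nsq (cR x * z) = x ^+ 2 * nsq z.
Proof. by case: z => a b; rewrite /nsq /=; ring. Qed.

Lemma trmxC_mul m n p (A : 'M[C R]_(m, n)) (B : 'M[C R]_(n, p)) :
  (A *m B)^t* = B^t* *m A^t*.
Proof. by rewrite trmx_mul map_mxM. Qed.

Lemma trmxCD m n (A B : 'M[C R]_(m, n)) : (A + B)^t* = A^t* + B^t*.
Proof. by rewrite linearD map_mxD. Qed.

Lemma trmxCB m n (A B : 'M[C R]_(m, n)) : (A - B)^t* = A^t* - B^t*.
Proof. by rewrite linearB map_mxB. Qed.

Lemma trmxCZ m n (c : R) (A : 'M[C R]_(m, n)) : (cR c *: A)^t* = cR c *: A^t*.
Proof. by rewrite linearZ map_mxZ; congr (_ *: _); exact: conj_cR. Qed.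

Definition rdiag n (a : 'rV[R]_n) : 'M[C R]_n := diag_mx (map_mx (@cR R) a).

Lemma trmxC_rdiag n (a : 'rV[R]_n) : (rdiag a)^t* = rdiag a.
Proof.
apply/matrixP => i j; rewrite !mxE; case: eqVneq => [->|ji].
  by rewrite !mulr1n conj_cR.
by rewrite !mulr0n conjC0.
Qed.

Definition udiag n (U : 'M[C R]_n) (a : 'rV[R]_n) : 'M[C R]_n :=
  U^t* *m rdiag a *m U.

Lemma unitarymxPl n (U : 'M[C R]_n) : U \is unitarymx -> U^t* *m U = 1%:M.
Proof. by move=> Uu; rewrite -(mul1mx (U^t*)) mulmxKtV. Qed.

Lemma unitarymxPr n (U : 'M[C R]_n) : U \is unitarymx -> U *m U^t* = 1%:M.
Proof. by move/unitarymxP. Qed.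

Lemma hermmxP n (A : 'M[C R]_n) : reflect (A^t* = A) (A \is hermsymmx).
Proof.
apply: (iffP (is_hermitianmxP _ _ _)); rewrite expr0 scale1r; first by move=> <-.
by move=> ->.
Qed.

Lemma rdiagM n (a b : 'rV[R]_n) :
  rdiag a *m rdiag b = rdiag (\row_i (a 0 i * b 0 i)).
Proof.
rewrite /rdiag mulmx_diag; congr diag_mx.
by apply/rowP => i; rewrite !mxE cRM.
Qed.

Lemma udiagM n (U : 'M[C R]_n) a b : U \is unitarymx ->
  udiag U a *m udiag U b = udiag U (\row_i (a 0 i * b 0 i)).
Proof.
move=> Uu; rewrite /udiag -rdiagM !mulmxA.
by rewrite (mulmxtVK _ Uu).
Qed.

Lemma udiag_herm n (U : 'M[C R]_n) a : (udiag U a)^t* = udiag U a.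
Proof. by rewrite /udiag !trmxC_mul trmxCK trmxC_rdiag mulmxA. Qed.

Lemma udiag1 n (U : 'M[C R]_n) : U \is unitarymx -> udiag U (const_mx 1) = 1%:M.
Proof.
move=> Uu; rewrite /udiag (_ : rdiag _ = 1%:M) ?mulmx1 ?unitarymxPl //.
by apply/matrixP => i j; rewrite !mxE.
Qed.

Lemma udiagD n (U : 'M[C R]_n) a b : udiag U (a + b) = udiag U a + udiag U b.
Proof.
rewrite /udiag -mulmxDl -mulmxDr; congr (_ *m _ *m _).
by apply/matrixP => i j; rewrite !mxE cRD mulrnDl.
Qed.

Lemma udiagZ n (U : 'M[C R]_n) c a : udiag U (c *: a) = cR c *: udiag U a.
Proof.
rewrite /udiag scalemxAl scalemxAr; congr (_ *m _ *m _).
by apply/matrixP => i j; rewrite !mxE cRM mulrnAr.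
Qed.

Lemma herm_udiag n (A : 'M[C R]_n) : A^t* = A ->
  exists (U : 'M[C R]_n) (a : 'rV[R]_n), U \is unitarymx /\ A = udiag U a.
Proof.
move=> /hermmxP hA.
have Uu := spectral_unitarymx A.
exists (spectralmx A), (map_mx Re (spectral_diag A)); split => //.
have /hermitian_normalmx /orthomx_spectralP {1}-> := hA.
rewrite /udiag (invmx_unitary Uu).
suff -> : rdiag (map_mx Re (spectral_diag A)) = diag_mx (spectral_diag A) by [].
rewrite /rdiag; congr diag_mx; apply/rowP => i; rewrite !mxE.
have /mxOverP/(_ 0 i) := hermitian_spectral_diag_real hA.
by case: (spectral_diag A 0 i) => x y; rewrite complex_real /= => /eqP ->.
Qed.

Lemma rdiag_mulE n m (a : 'rV[R]_n) (W : 'M[C R]_(n, m)) i j :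
  (rdiag a *m W) i j = cR (a 0 i) * W i j.
Proof. by rewrite mul_diag_mx !mxE. Qed.

(* Every trace of a product of two Hermitian matrices has this shape. *)
Lemma rtr_rdiag n m (a : 'rV[R]_n) (b : 'rV[R]_m) (W : 'M[C R]_(n, m)) :
  rtr (rdiag a *m W *m rdiag b *m W^t*) =
  \sum_i \sum_j a 0 i * b 0 j * nsq (W i j).
Proof.
rewrite /rtr /mxtrace Re_sum; apply: eq_bigr => i _.
rewrite -!mulmxA rdiag_mulE mxE Re_cRM Re_sum mulr_sumr.
apply: eq_bigr => j _; rewrite -mulrA; congr (_ * _).
by rewrite rdiag_mulE !mxE mulrCA nsqE -cRM.
Qed.

Lemma rtrC m n (A : 'M[C R]_(m, n)) (B : 'M[C R]_(n, m)) :
  rtr (A *m B) = rtr (B *m A).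
Proof. by rewrite /rtr mxtrace_mulC. Qed.

Lemma rtrD n (A B : 'M[C R]_n) : rtr (A + B) = rtr A + rtr B.
Proof. by rewrite /rtr linearD ReD. Qed.

Lemma rtrN n (A : 'M[C R]_n) : rtr (- A) = - rtr A.
Proof. by rewrite /rtr raddfN /=; move: (\tr A) => [x y]. Qed.

Lemma rtrB n (A B : 'M[C R]_n) : rtr (A - B) = rtr A - rtr B.
Proof. by rewrite rtrD rtrN. Qed.

Lemma rtrZ n c (A : 'M[C R]_n) : rtr (cR c *: A) = c * rtr A.
Proof. by rewrite /rtr linearZ Re_cRM. Qed.

Lemma rtr_rot4 n (P Q S T V W : 'M[C R]_n) :
  rtr (P *m Q *m S *m (T *m V *m W)) = rtr (Q *m (S *m T) *m V *m (W *m P)).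
Proof. by rewrite /rtr mxtrace_rot4. Qed.

Lemma rtr_udiagM n (U V : 'M[C R]_n) a b :
  rtr (udiag U a *m udiag V b) =
  \sum_i \sum_j a 0 i * b 0 j * nsq ((U *m V^t*) i j).
Proof.
by rewrite -rtr_rdiag trmxC_mul trmxCK rtr_rot4.
Qed.

Lemma psd_form n (A : 'M[C R]_n) (v : 'rV[C R]_n) :
  v *m A *m (map_mx Num.conj v)^T = v *m A *m v^t*.
Proof. by rewrite map_trmx. Qed.

Lemma form_udiag n (U : 'M[C R]_n) a (v : 'rV[C R]_n) :
  (v *m udiag U a *m v^t*) 0 0 = cR (\sum_i a 0 i * nsq ((v *m U^t*) 0 i)).
Proof.
rewrite /udiag !mulmxA (_ : v *m U^t* *m rdiag a *m U *m v^t* =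
  (v *m U^t*) *m (rdiag a *m (v *m U^t*)^t*)); last first.
  by rewrite trmxC_mul trmxCK !mulmxA.
rewrite mxE cR_sum; apply: eq_bigr => i _.
by rewrite rdiag_mulE cRM -nsqE mulrCA !mxE.
Qed.

Lemma lec0_cR (x : R) : (0 <= cR x) = (0 <= x).
Proof. by rewrite /cR lecE /= eqxx. Qed.

Lemma udiag_psd n (U : 'M[C R]_n) (a : 'rV[R]_n) : (forall i, 0 <= a 0 i) -> psdmx (udiag U a).
Proof.
move=> a0; split; first by apply/hermmxP/udiag_herm.
move=> v; rewrite psd_form form_udiag lec0_cR.
by apply: sumr_ge0 => i _; rewrite mulr_ge0 ?nsq_ge0.
Qed.

Lemma psd_udiag n (A : 'M[C R]_n) : psdmx A ->
  exists (U : 'M[C R]_n) (a : 'rV[R]_n), [/\ U \is unitarymx, forall i, 0 <= a 0 i & A = udiag U a].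
Proof.
move=> [/hermmxP hA pA]; have [U [a [Uu AE]]] := herm_udiag hA.
exists U, a; split => // i.
(* The quadratic form at the [i]-th eigenvector returns the eigenvalue [a 0 i]. *)
have := pA (row i U); rewrite psd_form AE form_udiag lec0_cR.
rewrite -row_mul unitarymxPr // (bigD1 i) //= big1 ?addr0.
  by rewrite !mxE eqxx (_ : nsq _ = 1) ?mulr1 // /nsq /= expr1n expr0n addr0.
move=> j ji; rewrite !mxE eq_sym (negbTE ji).
by rewrite (_ : nsq _ = 0) ?mulr0 // /nsq /= expr0n addr0.
Qed.

Lemma psd_herm n (A : 'M[C R]_n) : psdmx A -> A^t* = A.
Proof. by case=> /hermmxP. Qed.

Lemma psdD n (A B : 'M[C R]_n) : psdmx A -> psdmx B -> psdmx (A + B).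
Proof.
move=> pA pB; split.
  by apply/hermmxP; rewrite trmxCD !psd_herm.
move=> v; rewrite mulmxDr mulmxDl mxE addr_ge0 //; [exact: pA.2|exact: pB.2].
Qed.

Lemma psdZ n (c : R) (A : 'M[C R]_n) : 0 <= c -> psdmx A -> psdmx (cR c *: A).
Proof.
move=> c0 pA; split; first by apply/hermmxP; rewrite trmxCZ psd_herm.
move=> v; rewrite -scalemxAr -scalemxAl mxE mulr_ge0 ?lec0_cR //; exact: pA.2.
Qed.

Lemma psd_conj n m (A : 'M[C R]_n) (X : 'M[C R]_(m, n)) :
  psdmx A -> psdmx (X *m A *m X^t*).
Proof.
move=> pA; split.
  by apply/hermmxP; rewrite !trmxC_mul trmxCK psd_herm // mulmxA.
move=> v; rewrite psd_form (_ : _ *m _ *m _ = (v *m X) *m A *m (v *m X)^t*).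
  by rewrite -psd_form; exact: pA.2.
by rewrite trmxC_mul !mulmxA.
Qed.

Lemma psd_rtrM_ge0 n (A B : 'M[C R]_n) : psdmx A -> psdmx B -> 0 <= rtr (A *m B).
Proof.
move=> /psd_udiag[U [a [Uu a0 ->]]] /psd_udiag[V [b [Vu b0 ->]]].
rewrite rtr_udiagM; do 2 (apply: sumr_ge0 => ? _).
by rewrite !mulr_ge0 ?nsq_ge0.
Qed.

Lemma eigpow_cR (x a : R) : eigpow x (cR a) = cR (pw x a).
Proof. by rewrite /eigpow /pw /cR ltcE /= eqxx /=; case: ifP. Qed.

Definition pwv n (x : R) (a : 'rV[R]_n) : 'rV[R]_n := \row_i pw x (a 0 i).

(** Frees [mxpow] from the diagonalization chosen by [spectralmx]: any unitary one with real
    diagonal, such as a tensor power, computes the same matrix. *)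
Lemma mxpow_udiag n (U : 'M[C R]_n) a x : U \is unitarymx ->
  mxpow (udiag U a) x = udiag U (pwv x a).
Proof.
move=> Uu; set A := udiag U a.
have hA : A \is hermsymmx by apply/hermmxP/udiag_herm.
have /hermitian_normalmx /orthomx_spectralP := hA.
rewrite /mxpow (invmx_unitary (spectral_unitarymx A)) => AE.
have := @diag_mx_intertwine _ _ U (spectralmx A) (map_mx (@cR R) a)
  (spectral_diag A) (map_mx (@cR R) (pwv x a))
  (map_mx (eigpow x) (spectral_diag A)) Uu (spectral_unitarymx A) AE.
by rewrite /udiag /rdiag => -> // i j; rewrite !mxE => <-; rewrite eigpow_cR.
Qed.

End ComplexMatrices.

(** * Operator monotonicity and the inequality of Audenaert *)

Section OperatorMonotone.
Variable R : realType.
Local Open Scope sesquilinear_scope.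

(** Completing the square: after multiplication by [a + t] the difference of the two sides is
    [((a + t) y - t x)^2], so the minimum over [y] is at [y = t x / (a + t)]. *)
Lemma parallel_sum_le (a t x y : R) : 0 <= a -> 0 < t ->
  a * t / (a + t) * x ^+ 2 <= a * y ^+ 2 + t * (x - y) ^+ 2.
Proof.
move=> a0 t0; have at0 : 0 < a + t by rewrite ltr_wpDl.
rewrite mulrAC ler_pdivrMr // -subr_ge0.
rewrite (_ : _ - _ = ((a + t) * y - t * x) ^+ 2); last by ring.
exact: sqr_ge0.
Qed.

Lemma nsq_parallel_sum_le (a t : R) (x y : C R) : 0 <= a -> 0 < t ->
  a * t / (a + t) * nsq x <= a * nsq y + t * nsq (x - y).
Proof.
move=> a0 t0; case: x => x1 x2; case: y => y1 y2; rewrite /nsq /=.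
have := parallel_sum_le x1 y1 a0 t0; have := parallel_sum_le x2 y2 a0 t0.
rewrite !mulrDr; lra.
Qed.

Lemma nsq_form n (U : 'M[C R]_n) (v : 'rV[C R]_n) : U \is unitarymx ->
  cR (\sum_i nsq ((v *m U^t*) 0 i)) = (v *m v^t*) 0 0.
Proof.
move=> Uu; have := form_udiag U (const_mx 1) v.
rewrite udiag1 // mulmx1 => ->; congr cR.
by apply: eq_bigr => i _; rewrite [const_mx _ _ _]mxE mul1r.
Qed.

Lemma mul_udiagK n (U : 'M[C R]_n) c (v : 'rV[C R]_n) i : U \is unitarymx ->
  (v *m udiag U c *m U^t*) 0 i = cR (c 0 i) * (v *m U^t*) 0 i.
Proof.
move=> Uu; rewrite /udiag !mulmxA (mulmxtVK _ Uu) mul_mx_diag !mxE.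
by rewrite mulrC.
Qed.

Local Opaque mxpow udiag.

Lemma mulmxB0E m n (v u : 'rV[C R]_m) (W : 'M[C R]_(m, n)) i :
  ((v - u) *m W) 0 i = (v *m W) 0 i - (u *m W) 0 i.
Proof. by rewrite mulmxBl mxE [X in _ + X]mxE. Qed.

(* [a t / (a + t) |v|^2 = min_u a |u|^2 + t |v - u|^2]; the minimizer [u] for the
   larger operator is a competitor for the smaller one. *)
Lemma resolvent_monotone n (U V : 'M[C R]_n) (a b : 'rV[R]_n) (t : R)
    (v : 'rV[C R]_n) :
  U \is unitarymx -> V \is unitarymx ->
  (forall i, 0 <= a 0 i) -> (forall i, 0 <= b 0 i) ->
  psdmx (udiag V b - udiag U a) -> 0 < t ->
  \sum_i nsq ((v *m U^t*) 0 i) * (a 0 i / (a 0 i + t)) <=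
  \sum_i nsq ((v *m V^t*) 0 i) * (b 0 i / (b 0 i + t)).
Proof.
move=> Uu Vu a0 b0 ab t0; rewrite -(ler_pM2l t0).
pose c : 'rV[R]_n := \row_i (t / (b 0 i + t)).
pose u := v *m udiag V c.
have uV i : (u *m V^t*) 0 i = cR (t / (b 0 i + t)) * (v *m V^t*) 0 i.
  by rewrite mul_udiagK // mxE.
apply: (@le_trans _ _ (\sum_i a 0 i * nsq ((u *m U^t*) 0 i) +
                       t * \sum_i nsq (((v - u) *m U^t*) 0 i))).
  rewrite !mulr_sumr -big_split /=; apply: ler_sum => i _.
  have := nsq_parallel_sum_le ((v *m U^t*) 0 i) ((u *m U^t*) 0 i) (a0 i) t0.
  rewrite -mulmxB0E.
  by apply: le_trans; rewrite le_eqVlt; apply/orP; left; apply/eqP; ring.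
(* The norm of [v - u] is the same in both orthonormal bases. *)
have -> : \sum_i nsq (((v - u) *m U^t*) 0 i) = \sum_i nsq (((v - u) *m V^t*) 0 i).
  by apply: (@cR_inj R); rewrite !nsq_form.
apply: (@le_trans _ _ (\sum_i b 0 i * nsq ((u *m V^t*) 0 i) +
                       t * \sum_i nsq (((v - u) *m V^t*) 0 i))).
  rewrite lerD2r; have := ab.2 u.
  rewrite psd_form mulmxBr mulmxBl mxE [X in _ + X]mxE !form_udiag.
  by rewrite subr_ge0 lecE /= eqxx.
rewrite !mulr_sumr -big_split /=; apply: ler_sum => i _.
have -> : ((v - u) *m V^t*) 0 i = cR (b 0 i / (b 0 i + t)) * (v *m V^t*) 0 i.
  rewrite mulmxB0E uV -{1}(mul1r ((v *m V^t*) 0 i)) -mulrBl.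
  congr (_ * _); rewrite -cR1; apply/eqP; rewrite eq_complex /= subr0 eqxx andbT.
  by apply/eqP; field; rewrite gt_eqF // ltr_wpDl.
rewrite uV !nsq_cRM.
by rewrite le_eqVlt; apply/orP; left; apply/eqP; field; rewrite gt_eqF // ltr_wpDl.
Qed.

Lemma mxpow_herm n (A : 'M[C R]_n) s : A^t* = A -> (mxpow A s)^t* = mxpow A s.
Proof.
by move=> /herm_udiag[U [a [Uu ->]]]; rewrite (mxpow_udiag _ _ Uu) udiag_herm.
Qed.

Lemma mxpow_psd n (A : 'M[C R]_n) s : A^t* = A -> psdmx (mxpow A s).
Proof.
move=> /herm_udiag[U [a [Uu ->]]]; rewrite (mxpow_udiag _ _ Uu).
by apply: udiag_psd => i; rewrite mxE pw_ge0.
Qed.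

(** The Loewner-Heinz theorem. At each vector [v], [resolvent_monotone] supplies the hypothesis of
    [pw_sum_le], with the squared coordinates of [v] in the two eigenbases as weights. *)
Lemma mxpow_monotone n (A B : 'M[C R]_n) s : 0 < s -> s < 1 ->
  psdmx A -> psdmx B -> psdmx (B - A) -> psdmx (mxpow B s - mxpow A s).
Proof.
move=> s0 s1 pA pB ab.
have [U [a [Uu a0 AE]]] := psd_udiag pA; have [V [b [Vu b0 BE]]] := psd_udiag pB.
have AsE : mxpow A s = udiag U (pwv s a) by rewrite AE; exact: mxpow_udiag.
have BsE : mxpow B s = udiag V (pwv s b) by rewrite BE; exact: mxpow_udiag.
split; first by apply/hermmxP; rewrite AsE BsE trmxCB !udiag_herm.
rewrite AsE BsE {AsE BsE}; rewrite {}AE {}BE in ab.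
move=> v; rewrite psd_form mulmxBr mulmxBl mxE [X in _ + X]mxE !form_udiag.
rewrite subr_ge0 lecE /= eqxx /=.
have := @pw_sum_le _ s _ (fun i => a 0 i) (fun i => b 0 i)
  (fun i => nsq ((v *m U^t*) 0 i)) (fun i => nsq ((v *m V^t*) 0 i)) s0 s1 a0 b0.
move=> /(_ (fun _ => nsq_ge0 _) (fun _ => nsq_ge0 _)) h.
under eq_bigr do rewrite mxE mulrC.
under [leRHS]eq_bigr do rewrite mxE mulrC.
by apply: h => t; exact: resolvent_monotone.
Qed.

Lemma mxpowD n (A : 'M[C R]_n) s : psdmx A -> mxpow A s *m mxpow A (1 - s) = A.
Proof.
move=> /psd_udiag[U [a [Uu a0 AE]]].
have AsE x : mxpow A x = udiag U (pwv x a) by rewrite AE; exact: mxpow_udiag.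
rewrite !AsE AE (udiagM _ _ Uu); congr udiag; apply/rowP => i; rewrite !mxE /pw.
case: ltP => ai; last by rewrite mul0r; apply/le_anti; rewrite a0 ai.
rewrite -powRD; last by rewrite (gt_eqF ai) implybT.
by rewrite addrC subrK powRr1 // ltW.
Qed.

Definition rtrpow n (s t : R) (A B : 'M[C R]_n) : R := rtr (mxpow A s *m mxpow B t).

Lemma rtrM_monotone n (A B X : 'M[C R]_n) : psdmx X -> psdmx (B - A) ->
  rtr (A *m X) <= rtr (B *m X).
Proof. by move=> pX pBA; rewrite -subr_ge0 -rtrB -mulmxBl psd_rtrM_ge0. Qed.

Lemma rtrMB n (X Y Z : 'M[C R]_n) :
  rtr (X *m (Y - Z)) = rtr (X *m Y) - rtr (X *m Z).
Proof. by rewrite mulmxBr rtrB. Qed.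

Lemma addrBl_le (b p x : R) : b <= x -> b + p - x <= p.
Proof. by move=> bx; rewrite -addrA addrCA gerDl subr_le0. Qed.

(* Ozawa's argument: [A <= B + (A - B)_+], and [X^s] is operator monotone. *)
Lemma audenaert n (A B : 'M[C R]_n) s : 0 < s -> s < 1 ->
  psdmx A -> psdmx B ->
  exists2 T, is_test T &
    rtr (A *m (1%:M - T)) + rtr (B *m T) <= rtrpow s (1 - s) A B.
Proof.
move=> s0 s1 pA pB.
have [U [a [Uu abE]]] : exists (U : 'M[C R]_n) (a : 'rV[R]_n),
    U \is unitarymx /\ A - B = udiag U a.
  by apply: herm_udiag; rewrite trmxCB !psd_herm.
(* [T] projects onto the positive eigenspaces of [A - B], and [P] below is the positive part of
   [A - B]. *)
pose t : 'rV[R]_n := \row_i (0 < a 0 i)%R%:R.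
pose T := udiag U t.
have TcE : 1%:M - T = udiag U (\row_i (~~ (0 < a 0 i)%R)%:R).
  rewrite -(udiag1 Uu); apply/eqP; rewrite subr_eq -udiagD; apply/eqP.
  by congr udiag; apply/rowP => i; rewrite !mxE; case: (0 < a 0 i); rewrite ?addr0 ?add0r.
have Ttest : is_test T.
  split; first by apply: udiag_psd => i; rewrite mxE ler0n.
  by rewrite TcE; apply: udiag_psd => i; rewrite mxE ler0n.
exists T => //.
pose P := (A - B) *m T.
have PE : P = udiag U (\row_i (a 0 i * (0 < a 0 i)%R%:R)).
  by rewrite /P abE (udiagM _ _ Uu); congr udiag; apply/rowP => i; rewrite !mxE.
have pP : psdmx P.
  rewrite PE; apply: udiag_psd => i; rewrite mxE.
  by case: ltP => h; rewrite ?mulr0 // mulr1 ltW.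
have pD : psdmx (B + P - A).
  have -> : B + P - A = udiag U (\row_i (- a 0 i * (~~ (0 < a 0 i)%R)%:R)).
    have -> : B + P - A = cR (-1) *: udiag U a + P.
      rewrite -abE (_ : cR (-1) = -1) ?scaleN1r ?opprB; first by rewrite addrAC.
      by apply/eqP; rewrite eq_complex /= oppr0 !eqxx.
    rewrite PE -udiagZ -udiagD; congr udiag; apply/rowP => i; rewrite !mxE.
    by case: (0 < a 0 i); rewrite ?mulr1 ?mulr0 ?mulN1r ?addr0 ?addNr.
  apply: udiag_psd => i; rewrite mxE.
  by case: ltP => h; rewrite ?mulr0 // mulr1 oppr_ge0.
have pBP : psdmx (B + P) by exact: psdD.
have pBPB : psdmx (B + P - B) by rewrite addrC addKr.
have s0' : 0 < 1 - s by rewrite subr_gt0.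
have s1' : 1 - s < 1 by rewrite ltrBlDr ltrDl.
have -> : rtr (A *m (1%:M - T)) + rtr (B *m T) = rtr A - rtr P.
  by rewrite mulmxBr mulmx1 rtrB /P mulmxBl rtrB opprB addrA addrAC.
rewrite lerBlDr -lerBlDl.
have mono X : 0 < X -> X < 1 -> psdmx (mxpow (B + P) X - mxpow A X) /\
    psdmx (mxpow (B + P) X - mxpow B X).
  by move=> X0 X1; split; exact: mxpow_monotone.
set r := 1 - s in s0' s1' *.
have rs : 1 - r = s by rewrite /r opprB addrC subrK.
have pow (X : 'M[C R]_n) x : psdmx X -> psdmx (mxpow X x).
  by move=> pX; apply: mxpow_psd; exact: psd_herm.
have sE (X : 'M[C R]_n) : psdmx X -> rtr (mxpow X r *m mxpow X s) = rtr X.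
  by move=> pX; rewrite -rs mxpowD.
rewrite /rtrpow rtrC -(sE _ pA) -rtrB -mulmxBl.
(* The goal is now [Tr (A^r - B^r) A^s <= Tr P]. First [A^r], then [A^s], is enlarged to a power of
   [B + P]; the second step is allowed because [(B + P)^r - B^r] is positive. What remains is
   [Tr B <= Tr (B + P)^s B^r]. *)
apply: (@le_trans _ _ (rtr ((mxpow (B + P) r - mxpow B r) *m mxpow A s))).
  apply: rtrM_monotone; first exact: pow.
  rewrite opprB addrA subrK.
  exact: (mono r _ _).1.
rewrite rtrC.
apply: (@le_trans _ _ (rtr (mxpow (B + P) s *m (mxpow (B + P) r - mxpow B r)))).
  apply: rtrM_monotone; [exact: (mono r _ _).2|exact: (mono s _ _).1].
have E1 : rtr (mxpow (B + P) s *m mxpow (B + P) r) = rtr B + rtr P.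
  by rewrite rtrC (sE _ pBP) rtrD.
have E2 : rtr B <= rtr (mxpow (B + P) s *m mxpow B r).
  have -> : rtr B = rtr (mxpow B s *m mxpow B r).
    by rewrite -{1}(sE _ pB); exact: rtrC.
  apply: rtrM_monotone; first exact: (pow _ _ pB).
  exact: (mono s s0 s1).2.
apply: le_trans (addrBl_le (rtr P) E2).
by rewrite -E1 rtrMB.
Qed.

End OperatorMonotone.

(** * Tensor powers and tests *)

Lemma mxtrace_conj_square (K : numClosedFieldType) n (U V S D : 'M[K]_n) :
  map_mx Num.conj V^T *m V = 1%:M -> map_mx Num.conj S^T = S ->
  \tr (D *m (U *m S *m map_mx Num.conj V^T) *m 1%:M *m
       map_mx Num.conj (U *m S *m map_mx Num.conj V^T)^T) =
  \tr (map_mx Num.conj U^T *m D *m U *m (S *m S)).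
Proof.
move=> VV SS.
have VK : map_mx Num.conj (map_mx Num.conj V^T)^T = V by exact: trmxCK.
rewrite !trmx_mul !map_mxM SS VK mulmx1.
have -> : D *m (U *m S *m map_mx Num.conj V^T) *m (V *m (S *m map_mx Num.conj U^T)) =
  D *m U *m S *m (map_mx Num.conj V^T *m V) *m S *m map_mx Num.conj U^T.
  by rewrite !mulmxA.
by rewrite VV mulmx1 mxtrace_mulC !mulmxA.
Qed.

Section Tensor.
Import mxtens.
Variable K : comNzRingType.

Lemma mxtrace_tens m n (A : 'M[K]_m) (B : 'M[K]_n) :
  \tr (tensmx A B) = \tr A * \tr B.
Proof.
rewrite /mxtrace mulr_sum; apply: eq_bigr => i _.
by rewrite mxE.
Qed.

Lemma mxtrace_ntens d (A : 'M[K]_d) n : \tr (ntensmx_rec A n) = \tr A ^+ n.+1.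
Proof. by elim: n => //= n IH; rewrite mxtrace_tens IH -exprS. Qed.

Lemma ntensM d (A B : 'M[K]_d) n :
  ntensmx_rec (A *m B) n = ntensmx_rec A n *m ntensmx_rec B n.
Proof. by elim: n => //= n IH; rewrite IH -tensmx_mul. Qed.

Lemma tens1 m n : tensmx (1%:M : 'M[K]_m) (1%:M : 'M[K]_n) = 1%:M.
Proof.
apply/matrixP => i j; case: (mxtens_indexP i) => i1 i2.
case: (mxtens_indexP j) => j1 j2; rewrite tensmxE !mxE -natrM mulnb.
by rewrite (can_eq (@mxtens_indexK m n)) xpair_eqE.
Qed.

Lemma ntens1 d n : ntensmx_rec (1%:M : 'M[K]_d) n = 1%:M.
Proof. by elim: n => //= n ->; exact: tens1. Qed.

Lemma tens_diag m n (a : 'rV[K]_m) (b : 'rV[K]_n) :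
  tensmx (diag_mx a) (diag_mx b) =
  diag_mx (\row_k (a 0 (mxtens_unindex k).1 * b 0 (mxtens_unindex k).2)).
Proof.
apply/matrixP => i j; case: (mxtens_indexP i) => i1 i2.
case: (mxtens_indexP j) => j1 j2; rewrite tensmxE !mxE mxtens_indexK /=.
rewrite (can_eq (@mxtens_indexK m n)) xpair_eqE.
by case: (i1 == j1); case: (i2 == j2); rewrite ?mulr1n ?mulr0n ?mul0r ?mulr0.
Qed.

End Tensor.

Section TensorPowers.
Import mxtens.
Variable R : realType.
Local Open Scope sesquilinear_scope.

Lemma trmxC_ntens d (A : 'M[C R]_d) n :
  (ntensmx_rec A n)^t* = ntensmx_rec (A^t*) n.
Proof. by elim: n => //= n IH; rewrite trmx_tens map_mxT IH. Qed.

Lemma ntens_unitary d (U : 'M[C R]_d) n :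
  U \is unitarymx -> ntensmx_rec U n \is unitarymx.
Proof.
by move=> Uu; apply/unitarymxP; rewrite trmxC_ntens -ntensM unitarymxPr // ntens1.
Qed.

Lemma pwM x (a b : R) : 0 <= a -> 0 <= b -> pw x (a * b) = pw x a * pw x b.
Proof.
rewrite /pw !le_eqVlt => /orP[/eqP<-|a0]; first by rewrite mul0r ltxx mul0r.
case/orP => [/eqP<-|b0]; first by rewrite mulr0 ltxx mulr0.
by rewrite a0 b0 mulr_gt0 // powRM // ltW.
Qed.

(** A single [w] has to serve all exponents [x]: this is what makes powers commute with tensor
    powers in [mxpow_tpow]. *)
Lemma rdiag_ntens d (a : 'rV[R]_d) n : (forall i, 0 <= a 0 i) ->
  exists w : 'rV[R]_(d ^ n.+1), [/\ forall i, 0 <= w 0 i,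
    ntensmx_rec (rdiag a) n = rdiag w &
    forall x, ntensmx_rec (rdiag (pwv x a)) n = rdiag (pwv x w)].
Proof.
move=> a0; elim: n => [|n [w [w0 wE wxE]]]; first by exists a.
exists (\row_k (a 0 (mxtens_unindex k).1 * w 0 (mxtens_unindex k).2)).
split=> [i||x /=].
- by rewrite mxE mulr_ge0.
- rewrite /= wE tens_diag; congr diag_mx.
  by apply/rowP => k; rewrite !mxE cRM.
- rewrite wxE tens_diag; congr diag_mx.
  by apply/rowP => k; rewrite !mxE -cRM pwM.
Qed.

Lemma udiag_ntens d (U : 'M[C R]_d) (a : 'rV[R]_d) n :
  ntensmx_rec (udiag U a) n =
  (ntensmx_rec U n)^t* *m ntensmx_rec (rdiag a) n *m ntensmx_rec U n.
Proof. by rewrite /udiag !ntensM trmxC_ntens. Qed.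

Lemma tpowS d (A : 'M[C R]_d) n : tpow A n.+1 = ntensmx_rec A n.
Proof. by []. Qed.

Lemma mxpow_tpow d (A : 'M[C R]_d) n x : psdmx A ->
  mxpow (tpow A n.+1) x = tpow (mxpow A x) n.+1.
Proof.
move=> /psd_udiag[U [a [Uu a0 AE]]].
have AxE : mxpow A x = udiag U (pwv x a) by rewrite AE; exact: mxpow_udiag.
have [w [w0 wE wxE]] := rdiag_ntens n a0.
rewrite !tpowS AxE AE udiag_ntens wE udiag_ntens wxE.
exact: (mxpow_udiag w x (ntens_unitary n Uu)).
Qed.

Lemma tpow_psd d (A : 'M[C R]_d) n : psdmx A -> psdmx (tpow A n.+1).
Proof.
move=> /psd_udiag[U [a [Uu a0 AE]]].
have [w [w0 wE _]] := rdiag_ntens n a0.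
by rewrite tpowS AE udiag_ntens wE; exact: udiag_psd.
Qed.

(** Taking real parts commutes with powers on real numbers only, so [rtr_tpow] needs the trace
    itself to be real. *)
Lemma trace_herm_real n (A B : 'M[C R]_n) : A^t* = A -> B^t* = B ->
  \tr (A *m B) = cR (rtr (A *m B)).
Proof.
move=> hA hB; have : Num.conj (\tr (A *m B)) = \tr (A *m B).
  by rewrite -trace_map_mx -mxtrace_tr map_trmx trmxC_mul hA hB mxtrace_mulC.
rewrite /rtr conjE; case: (\tr _) => x y /= [] /eqP.
by rewrite -subr_eq0 -opprD oppr_eq0 -mulr2n mulrn_eq0 /= => /eqP ->.
Qed.

Lemma rtr_tpow d (A B : 'M[C R]_d) n : A^t* = A -> B^t* = B ->
  rtr (tpow A n.+1 *m tpow B n.+1) = rtr (A *m B) ^+ n.+1.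
Proof.
move=> hA hB; apply: (@cR_inj R); rewrite -trace_herm_real ?trmxC_ntens ?hA ?hB //.
rewrite !tpowS -ntensM mxtrace_ntens trace_herm_real //.
elim: n.+1 => [|k IH]; first by rewrite !expr0.
by rewrite !exprS cRM IH.
Qed.

Lemma rtrpow_tpow d (A B : 'M[C R]_d) n s t : psdmx A -> psdmx B ->
  rtrpow s t (tpow A n.+1) (tpow B n.+1) = rtrpow s t A B ^+ n.+1.
Proof.
move=> pA pB; rewrite /rtrpow !mxpow_tpow // rtr_tpow //.
  exact/mxpow_herm/psd_herm.
exact/mxpow_herm/psd_herm.
Qed.

Lemma mxpow0_test n (A : 'M[C R]_n) : psdmx A -> is_test (mxpow A 0).
Proof.
move=> /psd_udiag[U [a [Uu a0 AE]]].
have -> : mxpow A 0 = udiag U (pwv 0 a) by rewrite AE; exact: mxpow_udiag.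
have pwE (x : R) : pw 0 x = (0 < x)%R%:R by rewrite /pw powRr0; case: ifP.
split; first by apply: udiag_psd => i; rewrite mxE pw_ge0.
have -> : 1%:M - udiag U (pwv 0 a) = udiag U (\row_i (~~ (0 < a 0 i)%R)%:R).
  rewrite -(udiag1 Uu); apply/eqP; rewrite subr_eq -udiagD; apply/eqP.
  congr udiag; apply/rowP => i; rewrite !mxE pwE.
  by case: (0 < a 0 i); rewrite ?addr0 ?add0r.
by apply: udiag_psd => i; rewrite mxE ler0n.
Qed.

(** [T - T^2 = T (1 - T) T + (1 - T) T (1 - T)], a sum of two positive matrices. *)
Lemma test_sqr_le n (T : 'M[C R]_n) : is_test T -> psdmx (T - T *m T).
Proof.
move=> [pT pT'].
have := psdD (psd_conj T pT') (psd_conj (1%:M - T) pT).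
rewrite (psd_herm pT) (psd_herm pT') (mulmxBr T) mulmx1 (mulmxBl 1%:M) mul1mx.
by rewrite -mulmxDr (addrC T (1%:M - T)) subrK mulmx1.
Qed.

(** Inserting [V^t* *m V] between the two factors [S] turns the trace into a sum of squared entries,
    where only [U] is tied to the operator and the basis [V] is free. *)
Lemma rtr_conj_square n (U V S : 'M[C R]_n) (a : 'rV[R]_n) :
  V \is unitarymx -> S^t* = S ->
  rtr (udiag U a *m (S *m S)) = \sum_i \sum_j a 0 i * nsq ((U *m S *m V^t*) i j).
Proof.
move=> Vu hS.
have := @mxtrace_conj_square _ _ U V S (rdiag a) (unitarymxPl Vu) hS.
rewrite /rtr => <-.
have -> : 1%:M = rdiag (const_mx 1) :> 'M[C R]_n.
  by apply/matrixP => i j; rewrite !mxE.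
have := rtr_rdiag a (const_mx 1) (U *m S *m V^t*); rewrite /rtr => ->.
apply: eq_bigr => i _; apply: eq_bigr => j _.
by rewrite [const_mx _ _ _]mxE mulr1.
Qed.

Lemma nsqD_le (x y : C R) : nsq (x + y) <= 2 * (nsq x + nsq y).
Proof.
case: x => x1 x2; case: y => y1 y2; rewrite /nsq /= -subr_ge0.
rewrite (_ : _ - _ = (x1 - y1) ^+ 2 + (x2 - y2) ^+ 2); last by ring.
by rewrite addr_ge0 ?sqr_ge0.
Qed.

(* Nussbaum and Szkola's reduction of a quantum test to a classical one. *)
Lemma nussbaum_szkola n (U V T : 'M[C R]_n) (a b : 'rV[R]_n) (m : 'I_n -> 'I_n -> R) :
  U \is unitarymx -> V \is unitarymx ->
  (forall i, 0 <= a 0 i) -> (forall i, 0 <= b 0 i) -> is_test T ->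
  (forall i j, 0 <= m i j) ->
  (forall i j, m i j <= a 0 i) -> (forall i j, m i j <= b 0 j) ->
  \sum_i \sum_j m i j * nsq ((U *m V^t*) i j) <=
  2 * (rtr (udiag U a *m (1%:M - T)) + rtr (udiag V b *m T)).
Proof.
move=> Uu Vu a0 b0 tT m0 ma mb.
have hT : T^t* = T by apply: psd_herm; exact: tT.1.
have hT' : (1%:M - T)^t* = 1%:M - T by apply: psd_herm; exact: tT.2.
have tT' : is_test (1%:M - T).
  by split; [exact: tT.2|rewrite opprB addrC subrK; exact: tT.1].
have sq (W : 'M[C R]_n) (c : 'rV[R]_n) (S : 'M[C R]_n) :
    (forall i, 0 <= c 0 i) -> is_test S ->
    rtr (udiag W c *m (S *m S)) <= rtr (udiag W c *m S).
  move=> c0 tS; rewrite -subr_ge0 -rtrMB; apply: psd_rtrM_ge0.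
    exact: udiag_psd.
  exact: test_sqr_le.
(* Replacing [1 - T] and [T] by their squares only lowers the errors, and the squares expand into
   nonnegative sums over the same pairs of eigenvectors. *)
apply: (@le_trans _ _ (2 * (\sum_i \sum_j a 0 i * nsq ((U *m (1%:M - T) *m V^t*) i j)
    + \sum_i \sum_j b 0 j * nsq ((U *m T *m V^t*) i j)))); last first.
  rewrite ler_pM2l // lerD //.
    by rewrite -(rtr_conj_square _ _ Vu hT') sq.
  apply: le_trans (sq V b T b0 tT); rewrite (rtr_conj_square _ _ Uu hT).
  rewrite exchange_big /=; apply: ler_sum => i _; apply: ler_sum => j _.
  rewrite ler_wpM2l // (_ : U *m T *m V^t* = (V *m T *m U^t*)^t*).
    by rewrite !mxE nsq_conj.
  by rewrite !trmxC_mul trmxCK hT mulmxA.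
rewrite -big_split mulr_sumr; apply: ler_sum => i _ /=.
rewrite -big_split mulr_sumr; apply: ler_sum => j _ /=.
(* Each overlap splits into a part through [1 - T] and a part through [T]; the factor [2] is that of
   [nsqD_le]. *)
have -> : U *m V^t* = U *m (1%:M - T) *m V^t* + U *m T *m V^t*.
  by rewrite mulmxBr mulmx1 mulmxBl subrK.
rewrite [X in nsq X]mxE.
apply: le_trans (ler_wpM2l (m0 i j) (nsqD_le _ _)) _.
rewrite mulrCA ler_pM2l // mulrDr.
by apply: lerD; rewrite ler_wpM2r ?nsq_ge0.
Qed.

End TensorPowers.

(** * Exponential sums *)

(** From [expR (- y) >= 1 - y] and [(1 + y + 2 y^2) (1 - y) = 1 + y^2 (1 - 2 y) >= 1]. *)
Lemma expR_le_quad (R : realType) (y : R) : y <= 1 / 2 -> expR y <= 1 + y + 2 * y ^+ 2.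
Proof.
move=> y2; have h := expR_ge1Dx (- y).
have e0 := expR_gt0 y; have q0 : 0 <= 1 + y + 2 * y ^+ 2 by nra.
have E : expR y * expR (- y) = 1 by rewrite -expRD subrr expR0.
apply: (@le_trans _ _ (expR y * ((1 + y + 2 * y ^+ 2) * expR (- y)))); last first.
  by rewrite mulrCA E mulr1.
rewrite ler_peMr ?(ltW e0) //.
apply: le_trans (ler_wpM2l q0 h); rewrite -subr_ge0.
rewrite (_ : _ - _ = y ^+ 2 * (1 - 2 * y)); last by ring.
by rewrite mulr_ge0 ?sqr_ge0 // subr_ge0; lra.
Qed.

Section ExponentialSums.
Variables (R : realType) (K : finType) (c x : K -> R).
Hypothesis c_ge0 : forall k, 0 <= c k.

Definition expsum (t : R) : R := \sum_k c k * expR (t * x k).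
(** Where [expsum t] is positive, this is the derivative of [ln (expsum t)]: the mean of [x] under
    the tilted weights. *)
Definition expmean (t : R) : R := (\sum_k c k * expR (t * x k) * x k) / expsum t.

Lemma expsum_eq0 s t : expsum s = 0 -> expsum t = 0.
Proof.
move=> /psumr_eq0P H; apply: big1 => k _.
have /eqP := H (fun k _ => mulr_ge0 (c_ge0 k) (expR_ge0 _)) k isT.
by rewrite mulf_eq0 expR_eq0 orbF => /eqP ->; rewrite mul0r.
Qed.

Variable al : R.
Hypothesis Z_gt0 : 0 < expsum al.
Local Notation u := (fun k => c k * expR (al * x k)).
Local Notation mu := (expmean al).

Lemma u_ge0 k : 0 <= u k. Proof. by rewrite mulr_ge0 ?expR_ge0. Qed.

Lemma expmeanP : \sum_k u k * (x k - mu) = 0.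
Proof.
under eq_bigr do rewrite mulrBr.
by rewrite big_split /= sumrN -mulr_suml /expmean mulrC divfK ?subrr // gt_eqF.
Qed.

Lemma expsum_tilt t : expsum t = expR ((t - al) * mu) *
  \sum_k u k * expR ((t - al) * (x k - mu)).
Proof.
rewrite mulr_sumr; apply: eq_bigr => k _.
rewrite mulrCA -mulrA -!expRD; congr (_ * expR _); ring.
Qed.

Lemma expsum_affine s : expsum al = \sum_k u k * (1 + s * (x k - mu)).
Proof.
under eq_bigr do rewrite mulrDr mulr1 mulrCA.
by rewrite big_split /= -mulr_sumr expmeanP mulr0 addr0.
Qed.

(** Convexity of the logarithm of [expsum]: [1 + y <= expR y] is averaged over the tilted weights,
    under which the linear term has mean zero. *)
Lemma expsum_tangent t : expsum al * expR ((t - al) * mu) <= expsum t.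
Proof.
rewrite (expsum_tilt t) mulrC ler_pM2l ?expR_gt0 //.
rewrite (expsum_affine (t - al)); apply: ler_sum => k _.
by rewrite ler_wpM2l ?u_ge0 // expR_ge1Dx.
Qed.

(** Since [1 + y < expR y] for [y != 0], one point of positive weight away from the mean already
    makes the tangent inequality strict. *)
Lemma expsum_tangent_eq t : t != al ->
  expsum t <= expsum al * expR ((t - al) * mu) ->
  forall k, 0 < c k -> x k = mu.
Proof.
move=> tal Zt k ck; apply/eqP; rewrite -subr_eq0; apply/negPn/negP => xk.
suff : expsum al * expR ((t - al) * mu) < expsum t by rewrite ltNge Zt.
rewrite (expsum_tilt t) mulrC ltr_pM2l ?expR_gt0 //.
rewrite (expsum_affine (t - al)) (bigD1 k) //= [ltRHS](bigD1 k) //=; apply: ltr_leD.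
  rewrite ltr_pM2l ?mulr_gt0 ?expR_gt0 //.
  by apply: expR_gt1Dx; rewrite mulf_neq0 // subr_eq0.
apply: ler_sum => j _.
by rewrite ler_wpM2l ?u_ge0 // expR_ge1Dx.
Qed.

Lemma expsum_diff e : 0 < e -> exists2 h0, 0 < h0 &
  forall h, h != 0 -> `|h| <= h0 ->
  expsum (al + h) < expsum al * expR (h * mu + `|h| * e).
Proof.
(* The summand [1] makes [M] bound [|x k - mu|] as well as its square. *)
move=> e0; pose M := 1 + \sum_k (x k - mu) ^+ 2.
have M0 : 1 <= M by rewrite lerDl sumr_ge0 // => k _; exact: sqr_ge0.
have xM k : (x k - mu) ^+ 2 <= M.
  rewrite /M (bigD1 k) //= addrCA lerDl addr_ge0 // sumr_ge0 // => j _; exact: sqr_ge0.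
have M0' : 0 < M by lra.
(* The first bound keeps [h * (x k - mu)] at most [1 / 2], as [expR_le_quad] asks; the second keeps
   the remainder [2 * h ^+ 2 * M] below [|h| * e]. *)
exists (Num.min (1 / (2 * M)) (e / (4 * M))).
  by rewrite lt_min !divr_gt0 ?mulr_gt0.
move=> h h0; rewrite le_min => /andP[h1 h2].
have hgt0 : 0 < `|h| by rewrite normr_gt0.
rewrite expRD mulrA (expsum_tilt (al + h)) (_ : al + h - al = h); last by ring.
rewrite [X in _ < X * _]mulrC -mulrA ltr_pM2l ?expR_gt0 //.
apply: (@le_lt_trans _ _ (expsum al * (1 + 2 * h ^+ 2 * M))).
  apply: (@le_trans _ _ (\sum_k (u k * (1 + 2 * h ^+ 2 * M) + h * (u k * (x k - mu))))).
    apply: ler_sum => k _.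
    rewrite (mulrCA h) -mulrDr ler_wpM2l ?u_ge0 //.
    have xk1 : `|x k - mu| <= M.
      have [l1|l1] := leP `|x k - mu| 1; first exact: le_trans l1 M0.
      by apply: le_trans (xM k); rewrite -real_normK ?num_real // expr2 ler_peMr // ltW.
    have yle : h * (x k - mu) <= 1 / 2.
      apply: le_trans (ler_norm _) _; rewrite normrM.
      apply: le_trans (ler_pM _ _ h1 xk1) _ => //.
      by rewrite le_eqVlt; apply/orP; left; apply/eqP; field; rewrite gt_eqF.
    apply: le_trans (expR_le_quad yle) _.
    rewrite exprMn; have := xM k; have : 0 <= h ^+ 2 by exact: sqr_ge0.
    nra.
  by rewrite big_split /= -mulr_sumr expmeanP mulr0 addr0 -mulr_suml.
rewrite ltr_pM2l //; apply: (@lt_le_trans _ _ (1 + `|h| * e)); last exact: expR_ge1Dx.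
rewrite ltrD2l -real_normK ?num_real // (_ : 2 * _ * M = `|h| * (2 * `|h| * M)); last by ring.
rewrite ltr_pM2l //; move: h2; rewrite ler_pdivlMr ?mulr_gt0 // => h2; nra.
Qed.

End ExponentialSums.

(** * The Petz trace as an exponential sum *)

Section PetzTraces.
Variable R : realType.
Local Open Scope sesquilinear_scope.
Local Opaque mxpow udiag.

Lemma rtrpow_udiag n (U V : 'M[C R]_n) (a b : 'rV[R]_n) s t :
  U \is unitarymx -> V \is unitarymx ->
  rtrpow s t (udiag U a) (udiag V b) =
  \sum_i \sum_j pw s (a 0 i) * pw t (b 0 j) * nsq ((U *m V^t*) i j).
Proof.
move=> Uu Vu; rewrite /rtrpow (mxpow_udiag _ _ Uu) (mxpow_udiag _ _ Vu) rtr_udiagM.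
apply: eq_bigr => i _; apply: eq_bigr => j _.
by rewrite [pwv s a 0 i]mxE [pwv t b 0 j]mxE.
Qed.

Lemma pwE (s a : R) : 0 < a -> pw s a = expR (s * ln a).
Proof. by move=> a0; rewrite /pw a0 /powR gt_eqF. Qed.

(** For positive eigenvalues, [a^t b^(1-t) = b expR (t (ln a - ln b))]. Thus [x] is the
    log-likelihood ratio and [c] is the second Nussbaum-Szkola measure, set to [0] on pairs where an
    eigenvalue vanishes. *)
Lemma rtrpow_expsum n (A B : 'M[C R]_n) : psdmx A -> psdmx B ->
  exists c x : 'I_n * 'I_n -> R, (forall k, 0 <= c k) /\
    forall t, rtrpow t (1 - t) A B = expsum c x t.
Proof.
move=> /psd_udiag[U [a [Uu a0 ->]]] /psd_udiag[V [b [Vu b0 ->]]].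
exists (fun k => if (0 < a 0 k.1) && (0 < b 0 k.2)
        then b 0 k.2 * nsq ((U *m V^t*) k.1 k.2) else 0).
exists (fun k => ln (a 0 k.1) - ln (b 0 k.2)); split=> [k|t].
  by case: ifP => // _; rewrite mulr_ge0 ?nsq_ge0.
rewrite (rtrpow_udiag _ _ _ _ Uu Vu) pair_bigA; apply: eq_bigr => -[i j] _ /=.
have [ai|ai] /= := ltP 0 (a 0 i); last by rewrite /pw ltNge ai /= !mul0r.
have [bj|bj] /= := ltP 0 (b 0 j); last by rewrite /pw [0 < b 0 j]ltNge bj /= mulr0 !mul0r.
rewrite !pwE // -expRD mulrAC; congr (_ * _).
rewrite -{2}(lnK bj) -expRD; congr expR; ring.
Qed.

Lemma petz_ge0 n (A B : 'M[C R]_n) s t : psdmx A -> psdmx B -> 0 <= rtrpow s t A B.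
Proof.
by move=> pA pB; apply: psd_rtrM_ge0; apply: mxpow_psd; exact: psd_herm.
Qed.

Lemma petz_eq0 n (A B : 'M[C R]_n) s t : psdmx A -> psdmx B ->
  rtrpow s (1 - s) A B = 0 -> rtrpow t (1 - t) A B = 0.
Proof.
move=> pA pB; have [c [x [c0 E]]] := rtrpow_expsum pA pB.
by rewrite !E; exact: expsum_eq0.
Qed.

(** Here [mu] is the derivative at [al] of the logarithm of the Petz trace. The three clauses are
    the tangent inequality, its rigidity in the equality case, and the first-order expansion on both
    sides of [al]. *)
Lemma petz_tangent n (A B : 'M[C R]_n) al : psdmx A -> psdmx B ->
  0 < rtrpow al (1 - al) A B -> exists mu : R,
  [/\ forall t, rtrpow al (1 - al) A B * expR ((t - al) * mu) <= rtrpow t (1 - t) A B,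
      forall t, t != al ->
        rtrpow t (1 - t) A B <= rtrpow al (1 - al) A B * expR ((t - al) * mu) ->
        forall s, rtrpow s (1 - s) A B = rtrpow al (1 - al) A B * expR ((s - al) * mu) &
      forall e, 0 < e -> exists2 h, 0 < h &
        rtrpow (al + h) (1 - (al + h)) A B < rtrpow al (1 - al) A B * expR (h * mu + h * e) /\
        rtrpow (al - h) (1 - (al - h)) A B < rtrpow al (1 - al) A B * expR (- h * mu + h * e)].
Proof.
move=> pA pB; have [c [x [c0 E]]] := rtrpow_expsum pA pB.
rewrite E => Z0; exists (expmean c x al); split.
- by move=> t; rewrite E; exact: expsum_tangent.
- move=> t tal; rewrite E => Zt s; rewrite E.
  have xE := expsum_tangent_eq c0 Z0 tal Zt.
  rewrite /expsum mulr_suml; apply: eq_bigr => k _.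
  have := c0 k; rewrite le_eqVlt => /orP[/eqP <-|ck]; first by rewrite !mul0r.
  by rewrite (xE k ck) -mulrA -expRD; congr (_ * expR _); ring.
- move=> e e0; have [h h0 H] := expsum_diff c0 Z0 e0; exists h => //.
  rewrite !E; split.
    by have := H h; rewrite (gt_eqF h0) gtr0_norm // lexx => /(_ isT isT).
  by have := H (- h); rewrite oppr_eq0 (gt_eqF h0) normrN gtr0_norm // lexx
    => /(_ isT isT).
Qed.

Lemma mxpow1 n (A : 'M[C R]_n) : psdmx A -> mxpow A 1 = A.
Proof.
move=> /psd_udiag[U [a [Uu a0 ->]]]; rewrite (mxpow_udiag _ _ Uu); congr udiag.
apply/rowP => i; rewrite mxE /pw; case: ltP => ai; first by rewrite powRr1 // ltW.
by apply/le_anti; rewrite a0 ai.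
Qed.

Lemma mxpow0_idl n (A : 'M[C R]_n) : psdmx A -> rtr (A *m mxpow A 0) = rtr A.
Proof.
move=> pA; congr rtr; case/psd_udiag: pA => U [a [Uu a0 AE]].
have A0E : mxpow A 0 = udiag U (pwv 0 a) by rewrite AE; exact: mxpow_udiag.
rewrite A0E AE (udiagM _ _ Uu); congr udiag; apply/rowP => i; rewrite !mxE /pw.
case: ltP => ai; first by rewrite powRr0 mulr1.
by rewrite mulr0; apply/le_anti; rewrite a0 ai.
Qed.

Lemma density_psd n (A : 'M[C R]_n) : density A -> psdmx A.
Proof. by case. Qed.

Lemma density_rtr n (A : 'M[C R]_n) : density A -> rtr A = 1.
Proof. by case=> _; rewrite /rtr => ->. Qed.

Lemma density_tpow d (A : 'M[C R]_d) n : density A -> density (tpow A n.+1).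
Proof.
move=> [pA tA]; split; first exact: tpow_psd.
by rewrite tpowS mxtrace_ntens tA expr1n.
Qed.

Lemma test_rtr_ge0 n (A T : 'M[C R]_n) : density A -> is_test T -> 0 <= rtr (A *m T).
Proof. by move=> [pA _] [pT _]; exact: psd_rtrM_ge0. Qed.

Lemma test_rtrC n (A T : 'M[C R]_n) : density A ->
  rtr (A *m (1%:M - T)) = 1 - rtr (A *m T).
Proof. by move=> dA; rewrite rtrMB mulmx1 density_rtr. Qed.

Lemma test_compl n (T : 'M[C R]_n) : is_test T -> is_test (1%:M - T).
Proof.
move=> [pT pT']; split; first exact: pT'.
have -> : 1%:M - (1%:M - T) = T by exact: subKr.
exact: pT.
Qed.

Lemma test_rtr_le1 n (A T : 'M[C R]_n) : density A -> is_test T -> rtr (A *m T) <= 1.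
Proof.
move=> dA tT; rewrite -subr_ge0 -test_rtrC //.
exact: test_rtr_ge0 (test_compl tT).
Qed.

Lemma petz1_le1 n (A B : 'M[C R]_n) : density A -> density B -> rtrpow 1 0 A B <= 1.
Proof.
move=> dA dB; rewrite /rtrpow (mxpow1 (density_psd dA)).
by apply: test_rtr_le1 => //; apply: mxpow0_test; exact: density_psd.
Qed.

Lemma rtrpowC n (A B : 'M[C R]_n) s t : rtrpow s t A B = rtrpow t s B A.
Proof. exact: rtrC. Qed.

Local Opaque rtrpow.

(** The tangent is evaluated at [0] and [1], where the Petz trace is the probability that one state
    passes the support projection of the other, hence at most [1]. *)
Lemma petz_tangent_bounds n (A B : 'M[C R]_n) al mu : density A -> density B ->
  0 < al -> al < 1 -> 0 < rtrpow al (1 - al) A B ->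
  (forall t, rtrpow al (1 - al) A B * expR ((t - al) * mu) <= rtrpow t (1 - t) A B) ->
  ln (rtrpow al (1 - al) A B) <= al * mu /\
  ln (rtrpow al (1 - al) A B) <= - (1 - al) * mu.
Proof.
move=> dA dB al0 al1 Z0 H.
have aux z : rtrpow al (1 - al) A B * expR z <= 1 -> ln (rtrpow al (1 - al) A B) <= - z.
  move=> h; rewrite -ler_expR lnK ?posrE // expRN -[leRHS]mul1r.
  by rewrite ler_pdivlMr ?expR_gt0.
have Z0le : rtrpow 0 (1 - 0) A B <= 1.
  have -> : 1 - 0 = 1 :> R by exact: subr0.
  by rewrite rtrpowC; exact: petz1_le1.
have Z1le : rtrpow 1 (1 - 1) A B <= 1.
  have -> : 1 - 1 = 0 :> R by exact: subrr.
  exact: petz1_le1.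
split.
  have -> : al * mu = - ((0 - al) * mu) by ring.
  exact: aux (le_trans (H 0) Z0le).
have -> : - (1 - al) * mu = - ((1 - al) * mu) by ring.
exact: aux (le_trans (H 1) Z1le).
Qed.

End PetzTraces.

(** * Converse bounds *)

Section Converse.
Variable R : realType.
Local Open Scope sesquilinear_scope.
Local Opaque mxpow udiag.

(* Where the log-likelihood ratio lies in [lo, hi] the left-hand side is at most
   [a^al b^(1-al)], elsewhere one of the two Chernoff corrections exceeds it. *)
Lemma tilted_min_le (a b al h lo hi : R) : 0 <= a -> 0 <= b ->
  0 < al -> al < 1 -> 0 < h ->
  pw al a * pw (1 - al) b
    - expR (- (h * hi)) * (pw (al + h) a * pw (1 - (al + h)) b)
    - expR (h * lo) * (pw (al - h) a * pw (1 - (al - h)) b)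
  <= Num.min (expR (- ((1 - al) * lo)) * a) (expR (al * hi) * b).
Proof.
move=> a0 b0 al0 al1 h0.
have m0 : 0 <= Num.min (expR (- ((1 - al) * lo)) * a) (expR (al * hi) * b).
  by rewrite le_min !mulr_ge0 ?expR_ge0.
move: a0; rewrite le_eqVlt => /orP[/eqP a0|a0].
  by move: m0; rewrite -a0 /pw ltxx !mul0r !mulr0 !subr0.
move: b0; rewrite le_eqVlt => /orP[/eqP b0|b0].
  by move: m0; rewrite -b0 /pw ltxx !mulr0 !subr0.
rewrite !pwE // -!expRD.
(* [x] is the log-likelihood ratio, and [expR l] is [a^al b^(1-al)]. *)
pose x := ln a - ln b; pose l := al * ln a + (1 - al) * ln b.
have -> : - (h * hi) + ((al + h) * ln a + (1 - (al + h)) * ln b) = l + h * (x - hi).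
  by rewrite /l /x; ring.
have -> : h * lo + ((al - h) * ln a + (1 - (al - h)) * ln b) = l + h * (lo - x).
  by rewrite /l /x; ring.
have aE : expR (- ((1 - al) * lo)) * a = expR (l + (1 - al) * (x - lo)).
  rewrite -{1}(lnK a0) -expRD; congr expR; rewrite /l /x; ring.
have bE : expR (al * hi) * b = expR (l + al * (hi - x)).
  rewrite -{1}(lnK b0) -expRD; congr expR; rewrite /l /x; ring.
rewrite -/l; have l0 := expR_gt0 l; have al1' : 0 < 1 - al by rewrite subr_gt0.
have [xhi|xhi] := leP x hi; last first.
  apply: le_trans m0; rewrite subr_le0; apply: le_trans (expR_ge0 _).
  by rewrite subr_le0 ler_expR lerDl mulr_ge0 ?subr_ge0 // ltW.
have [xlo|xlo] := leP lo x; last first.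
  apply: le_trans m0; rewrite addrAC subr_le0; apply: le_trans (expR_ge0 _).
  by rewrite subr_le0 ler_expR lerDl mulr_ge0 ?subr_ge0 // ltW.
apply: (@le_trans _ _ (expR l)).
  by rewrite -addrA gerDl -opprD oppr_le0 addr_ge0 ?expR_ge0.
rewrite aE bE le_min !ler_expR !lerDl !mulr_ge0 ?subr_ge0 // ltW //.
Qed.

(** The reduction [nussbaum_szkola] is applied to rescaled [A] and [B], with [m] the minimum of the
    rescaled eigenvalues, which [tilted_min_le] bounds below term by term. *)
Lemma converse_one_shot n (A B T : 'M[C R]_n) (al h lo hi : R) :
  psdmx A -> psdmx B -> is_test T -> 0 < al -> al < 1 -> 0 < h ->
  rtrpow al (1 - al) A B
    - expR (- (h * hi)) * rtrpow (al + h) (1 - (al + h)) A B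
    - expR (h * lo) * rtrpow (al - h) (1 - (al - h)) A B
  <= 2 * (expR (- ((1 - al) * lo)) * rtr (A *m (1%:M - T))
          + expR (al * hi) * rtr (B *m T)).
Proof.
move=> /psd_udiag[U [a [Uu a0 ->]]] /psd_udiag[V [b [Vu b0 ->]]] tT al0 al1 h0.
have rtr_scale (W X : 'M[C R]_n) (c : R) (v : 'rV[R]_n) :
    c * rtr (udiag W v *m X) = rtr (udiag W (c *: v) *m X).
  by rewrite udiagZ -scalemxAl rtrZ.
rewrite (rtr_scale U) (rtr_scale V).
set c1 := expR (- ((1 - al) * lo)); set c2 := expR (al * hi).
have := @nussbaum_szkola _ _ U V T (c1 *: a) (c2 *: b)
  (fun i j => Num.min (c1 * a 0 i) (c2 * b 0 j)) Uu Vu _ _ tT.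
have e1 : 0 <= c1 by exact: expR_ge0.
have e2 : 0 <= c2 by exact: expR_ge0.
move=> H; apply: le_trans (H _ _ _ _ _); last first.
- by move=> i j; rewrite [(c2 *: b) 0 j]mxE ge_min lexx orbT.
- by move=> i j; rewrite [(c1 *: a) 0 i]mxE ge_min lexx.
- by move=> i j; rewrite le_min !mulr_ge0.
- by move=> i; rewrite mxE mulr_ge0.
- by move=> i; rewrite mxE mulr_ge0.
rewrite !(rtrpow_udiag _ _ _ _ Uu Vu) !mulr_sumr -!sumrB; apply: ler_sum => i _.
rewrite !mulr_sumr -!sumrB; apply: ler_sum => j _.
rewrite !mulrA -!mulrBl -!mulrA ler_wpM2r ?nsq_ge0 //.
exact: tilted_min_le.
Qed.

Local Opaque rtrpow.

Lemma expr_eventually_small (q : R) : 0 <= q -> q < 1 ->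
  exists N0, forall n, (N0 <= n)%N -> q ^+ n.+1 <= 1 / 4.
Proof.
move=> q0 q1.
have : (fun n : nat => q ^+ n) @ \oo --> (0 : R).
  by apply: cvg_expr; rewrite ger0_norm.
move=> /cvgr_dist_lt/(_ (1 / 4))[]; first lra.
move=> N0 _ HN; exists N0 => n Nn; have := HN n.+1 (leqW Nn).
by rewrite /= sub0r normrN ger0_norm ?exprn_ge0 // => /ltW.
Qed.

Lemma quarter_le (z p m x : R) : 0 < z -> p <= 1 / 4 -> m <= 1 / 4 ->
  z - z * p - z * m <= 2 * x -> z / 4 <= x.
Proof.
move=> z0 hp hm H.
have : z * p <= z * (1 / 4) by rewrite ler_pM2l.
have : z * m <= z * (1 / 4) by rewrite ler_pM2l.
lra.
Qed.

(** The window for the log-likelihood ratio of [N] copies is [N (mu - e)] to [N (mu + e)]. By the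
    two strict hypotheses the corrections are [Z ^+ N] times the [N]-th powers of ratios below [1],
    hence eventually at most a quarter of [Z ^+ N] each. *)
Lemma converse_iid d (A B : 'M[C R]_d) (al h mu e : R) :
  psdmx A -> psdmx B -> 0 < al -> al < 1 -> 0 < h ->
  0 < rtrpow al (1 - al) A B ->
  rtrpow (al + h) (1 - (al + h)) A B < rtrpow al (1 - al) A B * expR (h * mu + h * e) ->
  rtrpow (al - h) (1 - (al - h)) A B < rtrpow al (1 - al) A B * expR (- h * mu + h * e) ->
  exists N0, forall n, (N0 <= n)%N -> forall T, is_test T ->
  rtrpow al (1 - al) A B ^+ n.+1 / 4 <=
    expR (- (n.+1%:R * (1 - al) * (mu - e))) * rtr (tpow A n.+1 *m (1%:M - T))
    + expR (n.+1%:R * al * (mu + e)) * rtr (tpow B n.+1 *m T).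
Proof.
move=> pA pB al0 al1 h0; set Z := rtrpow al _ A B => Z0.
set Zp := rtrpow (al + h) _ A B; set Zm := rtrpow (al - h) _ A B => Hp Hm.
pose qp := Zp * expR (- (h * mu + h * e)) / Z.
pose qm := Zm * expR (- (- h * mu + h * e)) / Z.
have qp0 : 0 <= qp by rewrite !mulr_ge0 ?expR_ge0 ?petz_ge0 // invr_ge0 ltW.
have qm0 : 0 <= qm by rewrite !mulr_ge0 ?expR_ge0 ?petz_ge0 // invr_ge0 ltW.
have qp1 : qp < 1 by rewrite ltr_pdivrMr // mul1r expRN ltr_pdivrMr ?expR_gt0.
have qm1 : qm < 1 by rewrite ltr_pdivrMr // mul1r expRN ltr_pdivrMr ?expR_gt0.
have [Np HNp] := expr_eventually_small qp0 qp1; have [Nm HNm] := expr_eventually_small qm0 qm1.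
exists (maxn Np Nm) => n; rewrite geq_max => /andP[/HNp{}HNp /HNm{}HNm] T tT.
set N := n.+1.
have := @converse_one_shot _ (tpow A N) (tpow B N) T al h (N%:R * (mu - e)) (N%:R * (mu + e))
  (tpow_psd n pA) (tpow_psd n pB) tT al0 al1 h0.
rewrite !rtrpow_tpow // -/Z -/Zp -/Zm.
have -> : (1 - al) * (N%:R * (mu - e)) = N%:R * (1 - al) * (mu - e) by ring.
have -> : al * (N%:R * (mu + e)) = N%:R * al * (mu + e) by ring.
have -> : expR (- (h * (N%:R * (mu + e)))) * Zp ^+ N = Z ^+ N * qp ^+ N.
  rewrite -exprMn /qp mulrC [in RHS]mulrC divfK ?gt_eqF // exprMn -expRM_natl.
  by congr (_ * expR _); ring.
have -> : expR (h * (N%:R * (mu - e))) * Zm ^+ N = Z ^+ N * qm ^+ N.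
  rewrite -exprMn /qm mulrC [in RHS]mulrC divfK ?gt_eqF // exprMn -expRM_natl.
  by congr (_ * expR _); ring.
exact: quarter_le (exprn_gt0 N Z0) HNp HNm.
Qed.

End Converse.

(** * Binary distributions *)

Section ExtendedReals.
Variable R : realType.
Local Open Scope ereal_scope.

Lemma limn_esup_le_near (u : (\bar R)^nat) (l : \bar R) :
  (forall e : R, (0 < e)%R -> exists N, forall n, (N <= n)%N -> u n <= l + e%:E) ->
  limn_esup u <= l.
Proof.
move=> H; apply/lee_addgt0Pr => e /H[N HN].
apply: (@le_trans _ _ (ereal_sup (u @` [set n | (N <= n)%N]))).
  apply: ereal_inf_lbound; exists [set n | (N <= n)%N] => //; exact: nbhs_infty_ge.
by apply: ge_ereal_sup => _ [n /= Nn <-]; exact: HN.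
Qed.

Lemma limn_esup_ge_near (u : (\bar R)^nat) (l : \bar R) (N : nat) :
  (forall n, (N <= n)%N -> l <= u n) -> l <= limn_esup u.
Proof.
move=> H; apply: le_ereal_inf_tmp => _ [V [M _ MV] <-].
apply: (@le_trans _ _ (u (maxn N M))); first exact/H/leq_maxl.
apply: ereal_sup_ubound; exists (maxn N M) => //; apply: MV; exact: leq_maxr.
Qed.

Lemma renyi_of_le (al s t : R) : (al < 1)%R -> (s <= t)%R ->
  renyi_of al t <= renyi_of al s.
Proof.
move=> al1 st; rewrite /renyi_of; case: (ltP 0%R s) => s0; last exact: leey.
rewrite (lt_le_trans s0 st) lee_fin ler_ndivrMr ?subr_lt0 // divfK ?ltr0_neq0 ?subr_lt0 //.
by rewrite ler_ln // posrE (lt_le_trans s0 st).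
Qed.

Lemma renyi_of_expn (al s : R) n : (0 <= s)%R ->
  (n.+1%:R^-1)%:E * renyi_of al (s ^+ n.+1) = renyi_of al s.
Proof.
rewrite le_eqVlt => /orP[/eqP <-|s0].
  by rewrite expr0n /renyi_of ltxx gt0_muley // lte_fin invr_gt0.
rewrite /renyi_of s0 exprn_gt0 // lnXn // -EFinM; congr EFin.
by rewrite -[(ln s *+ _)%R]mulr_natl !mulrA mulVf ?mul1r ?pnatr_eq0.
Qed.

End ExtendedReals.

(** * Lower bounds for the two-point sum from a weighted bound on the errors *)

Section TestSums.
Variable R : realType.

Lemma powR_halfM (p q : R) : 0 < p -> p < 1 -> 0 <= q -> q <= 1 / 2 ->
  1 / 2 <= powR (1 - q) p.
Proof.
move=> p0 p1 q0 q2; apply: (@le_trans _ _ (1 - q)); first lra.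
by apply: ger1_powR; [apply/andP; split; lra|exact: ltW].
Qed.

(** The constant [16] is [8 * 2]: the power [al] of [1 / 8] is at least [1 / 8], and the factor with
    [1 - e2] is at least [1 / 2]. *)
Lemma binary_sum_ge_half (al e1 e2 p X kap : R) : 0 < al -> al < 1 ->
  0 <= e1 -> 0 <= e2 -> e2 <= 1 / 2 ->
  expR p / 8 <= expR X * e1 -> kap <= al * (p - X) ->
  expR kap / 16 <= powR e1 al * powR (1 - e2) (1 - al).
Proof.
move=> al0 al1 e10 e20 e22 H kle.
have h1 : expR (p - X) / 8 <= e1.
  by rewrite -(ler_pM2l (expR_gt0 X)) mulrA -expRD addrC subrK.
have h2 : expR kap / 8 <= powR e1 al.
  apply: (@le_trans _ _ (powR (expR (p - X) / 8) al)); last first.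
    by rewrite ge0_ler_powR ?nnegrE ?divr_ge0 ?expR_ge0 // ltW.
  rewrite powRM ?expR_ge0 // -expRM ler_pM ?expR_ge0 //.
    by rewrite ler_expR mulrC.
  by apply: ger1_powR; [apply/andP; split; lra|exact: ltW].
have h3 : 1 / 2 <= powR (1 - e2) (1 - al) by apply: powR_halfM => //; lra.
apply: le_trans (ler_pM _ _ h2 h3).
- by lra.
- by rewrite divr_ge0 ?expR_ge0.
- by lra.
Qed.

Lemma binary_sum_ge_small (al e1 e2 p X Y kap : R) : 0 < al -> al < 1 ->
  0 <= e1 -> e1 <= 1 / 2 -> 0 <= e2 -> e2 <= 1 / 2 ->
  expR p / 4 <= expR X * e1 + expR Y * e2 ->
  kap <= al * (p - X) -> kap <= (1 - al) * (p - Y) ->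
  expR kap / 16 <=
    powR (1 - e1) al * powR e2 (1 - al) + powR e1 al * powR (1 - e2) (1 - al).
Proof.
move=> al0 al1 e10 e11 e20 e22 H k1 k2.
have [h|h] := leP (expR p / 8) (expR X * e1).
  apply: le_trans (binary_sum_ge_half al0 al1 e10 e20 e22 h k1) _.
  by rewrite lerDr mulr_ge0 ?powR_ge0.
have {}h : expR p / 8 <= expR Y * e2 by lra.
have al0' : 0 < 1 - al by lra.
have al1' : 1 - al < 1 by lra.
apply: le_trans (binary_sum_ge_half al0' al1' e20 e10 e11 h k2) _.
by rewrite subKr mulrC lerDl mulr_ge0 ?powR_ge0.
Qed.

(** If both errors are small, the first weighted bound applies; if both are large, the complementary
    test and the second bound do. In the mixed cases one summand is at least [1 / 4], and [kap <= 0]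
    suffices. *)
Lemma binary_sum_ge (al e1 e2 p X Y kap : R) : 0 < al -> al < 1 ->
  0 <= e1 -> e1 <= 1 -> 0 <= e2 -> e2 <= 1 ->
  expR p / 4 <= expR X * e1 + expR Y * e2 ->
  expR p / 4 <= expR X * (1 - e1) + expR Y * (1 - e2) ->
  kap <= 0 -> kap <= al * (p - X) -> kap <= (1 - al) * (p - Y) ->
  expR kap / 16 <=
    powR (1 - e1) al * powR e2 (1 - al) + powR e1 al * powR (1 - e2) (1 - al).
Proof.
move=> al0 al1 e10 e11 e20 e21 H1 H2 k0 k1 k2.
have al0' : 0 < 1 - al by lra.
have al1' : 1 - al < 1 by lra.
have ek : expR kap <= 1 by rewrite -[leRHS]expR0 ler_expR.
have [a|a] := leP e1 (1 / 2); have [b|b] := leP e2 (1 / 2).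
- exact: (binary_sum_ge_small al0 al1 e10 a e20 b H1 k1 k2).
- have h1 := powR_halfM al0 al1 e10 a.
  have e2' : 1 - e2 <= 1 / 2 by lra.
  have e2'' : 0 <= 1 - e2 by lra.
  have := powR_halfM al0' al1' e2'' e2'; rewrite subKr => h2.
  have := mulr_ge0 (powR_ge0 e1 al) (powR_ge0 (1 - e2) (1 - al)).
  have half0 : 0 <= 1 / 2 :> R by lra.
  have := ler_pM half0 half0 h1 h2; lra.
- have h2 := powR_halfM al0' al1' e20 b.
  have e1' : 1 - e1 <= 1 / 2 by lra.
  have e1'' : 0 <= 1 - e1 by lra.
  have := powR_halfM al0 al1 e1'' e1'; rewrite subKr => h1.
  have := mulr_ge0 (powR_ge0 (1 - e1) al) (powR_ge0 e2 (1 - al)).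
  have half0 : 0 <= 1 / 2 :> R by lra.
  have := ler_pM half0 half0 h1 h2; lra.
- have := @binary_sum_ge_small al (1 - e1) (1 - e2) p X Y kap al0 al1.
  rewrite !subKr => Hs; rewrite addrC; apply: Hs => //; lra.
Qed.

End TestSums.

(** * Test divergences *)

Section TestDivergence.
Variable R : realType.
Local Open Scope sesquilinear_scope.
Local Opaque mxpow udiag.

Definition tsum n (al : R) (A B T : 'M[C R]_n) : R :=
  powR (rtr (A *m T)) al * powR (rtr (B *m T)) (1 - al) +
  powR (rtr (A *m (1%:M - T))) al * powR (rtr (B *m (1%:M - T))) (1 - al).

Lemma classD_tsum n al (A B T : 'M[C R]_n) :
  classD al (testdist T A) (testdist T B) = renyi_of al (tsum al A B T).
Proof. by rewrite /classD !big_ord_recl big_ord0 addr0. Qed.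

Lemma tsum_swap n al (A B T : 'M[C R]_n) : tsum al A B T = tsum (1 - al) B A T.
Proof.
have aux (a b c e : R) : a * b + c * e = b * a + e * c by ring.
by rewrite /tsum subKr; exact: aux.
Qed.

Lemma Dtest_ge n al (A B T : 'M[C R]_n) : is_test T ->
  (renyi_of al (tsum al A B T) <= Dtest al A B)%E.
Proof. by move=> tT; apply: ereal_sup_ubound; exists T => //; rewrite classD_tsum. Qed.

Lemma Dtest_le n al (A B : 'M[C R]_n) x :
  (forall T, is_test T -> (renyi_of al (tsum al A B T) <= x)%E) ->
  (Dtest al A B <= x)%E.
Proof. by move=> H; apply: ge_ereal_sup => _ [T tT <-]; rewrite classD_tsum; exact: H. Qed.

Lemma mxpowZ n (c t : R) (B : 'M[C R]_n) : 0 <= c -> psdmx B ->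
  mxpow (cR c *: B) t = cR (pw t c) *: mxpow B t.
Proof.
move=> c0 /psd_udiag[U [b [Uu b0 ->]]]; rewrite -udiagZ !(mxpow_udiag _ _ Uu) -udiagZ.
by congr udiag; apply/rowP => i; rewrite !mxE pwM.
Qed.

Lemma rtrpowZr n (c s t : R) (A B : 'M[C R]_n) : 0 <= c -> psdmx B ->
  rtrpow s t A (cR c *: B) = pw t c * rtrpow s t A B.
Proof. by move=> c0 pB; rewrite /rtrpow mxpowZ // -scalemxAr rtrZ. Qed.

(** When the Petz trace vanishes, the test from [audenaert] makes no error of either kind. *)
Lemma Dtest_orthogonal n al (A B : 'M[C R]_n) : 0 < al -> al < 1 ->
  density A -> density B -> rtrpow al (1 - al) A B = 0 -> Dtest al A B = +oo%E.
Proof.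
move=> al0 al1 dA dB Z0.
have [T tT] := audenaert al0 al1 (density_psd dA) (density_psd dB).
rewrite Z0 => le0.
have e10 := test_rtr_ge0 dA (test_compl tT); have e20 := test_rtr_ge0 dB tT.
have e1 : rtr (A *m (1%:M - T)) = 0.
  by apply/le_anti; rewrite e10 andbT (le_trans _ le0) // lerDl.
have e2 : rtr (B *m T) = 0.
  by apply/le_anti; rewrite e20 andbT (le_trans _ le0) // lerDr.
apply/eqP; rewrite -leye_eq; have := Dtest_ge al A B tT.
rewrite /tsum e1 e2 !powR0 ?(gt_eqF al0) ?subr_eq0 ?(gt_eqF al1) //.
by rewrite mulr0 mul0r addr0 /renyi_of ltxx.
Qed.

(* Audenaert's inequality for [A] and [c B], with [c] chosen so that both
   summands of [tsum] are bounded by the square root of the Petz trace. *)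
Lemma Dtest_lower n al (A B : 'M[C R]_n) : 0 < al -> al < 1 ->
  density A -> density B -> 0 < rtrpow al (1 - al) A B ->
  (renyi_of al (2 * expR (ln (rtrpow al (1 - al) A B) / 2)) <= Dtest al A B)%E.
Proof.
move=> al0 al1 dA dB Z0; set q := ln _.
have al1' : 0 < 1 - al by rewrite subr_gt0.
(* With [c = expR L] the errors are at most [expR (q / (2 al))] and [expR (q / (2 (1 - al)))], so
   their powers [al] and [1 - al] are both at most [expR (q / 2)]. *)
pose L := (1 - 2 * al) / (2 * al * (1 - al)) * q.
have [T tT] := audenaert al0 al1 (density_psd dA) (psdZ (expR_ge0 L) (density_psd dB)).
rewrite rtrpowZr ?expR_ge0 //; last exact: density_psd.
rewrite pwE ?expR_gt0 // expRK -scalemxAl rtrZ.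
rewrite -[X in _ <= _ * X]lnK // -/q -expRD.
set e1 := rtr (A *m _); set e2 := rtr (B *m T) => H.
have e10 : 0 <= e1 := test_rtr_ge0 dA (test_compl tT).
have e20 : 0 <= e2 := test_rtr_ge0 dB tT.
have h1 : e1 <= expR ((1 - al) * L + q).
  by apply: le_trans H; rewrite lerDl mulr_ge0 ?expR_ge0.
have h2 : e2 <= expR (q - al * L).
  rewrite -(ler_pM2l (expR_gt0 L)) -expRD (_ : L + _ = (1 - al) * L + q); last by ring.
  by apply: le_trans H; rewrite lerDr.
have p1 : powR e1 al <= expR (q / 2).
  apply: (@le_trans _ _ (powR (expR ((1 - al) * L + q)) al)).
    by rewrite ge0_ler_powR ?nnegrE ?expR_ge0 // ltW.
  rewrite -expRM ler_expR /L le_eqVlt; apply/orP; left; apply/eqP; field.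
  by rewrite !gt_eqF.
have p2 : powR e2 (1 - al) <= expR (q / 2).
  apply: (@le_trans _ _ (powR (expR (q - al * L)) (1 - al))).
    by rewrite ge0_ler_powR ?nnegrE ?expR_ge0 // ltW.
  rewrite -expRM ler_expR /L le_eqVlt; apply/orP; left; apply/eqP; field.
  by rewrite !gt_eqF.
apply: le_trans (Dtest_ge al A B tT); apply: renyi_of_le => //.
(* The other factor of each summand is a power of a probability, hence at most [1]. *)
have f1 (x t : R) : 0 <= x -> x <= 1 -> 0 <= t -> powR x t <= 1.
  move=> x0 x1 t0; have -> : 1 = powR 1 t by rewrite powR1.
  by rewrite ge0_ler_powR ?nnegrE.
have g1 : powR (rtr (A *m T)) al <= 1.
  by apply: f1 (ltW al0); [exact: test_rtr_ge0|exact: test_rtr_le1].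
have g2 : powR (rtr (B *m (1%:M - T))) (1 - al) <= 1.
  have tT' := test_compl tT.
  exact: (f1 _ _ (test_rtr_ge0 dB tT') (test_rtr_le1 dB tT') (ltW al1')).
rewrite (_ : 2 * expR (q / 2) = 1 * expR (q / 2) + expR (q / 2) * 1); last by ring.
by apply: lerD; apply: ler_pM; rewrite ?powR_ge0.
Qed.

Local Opaque rtrpow.

(** The factor [2] from [Dtest_lower] shifts the rate by [ln 2 / (al - 1) / N], which is at most [e]
    in absolute value for such [N]. *)
Lemma lower_rate (al z e N : R) : al < 1 -> 0 < e -> 0 < N ->
  `|ln 2 / (al - 1)| / e < N ->
  2^-1 * (z / (al - 1)) - e <= N^-1 * ((ln 2 + N * z / 2) / (al - 1)).
Proof.
move=> al1 e0 N0; rewrite ltr_pdivrMr // => H.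
rewrite (_ : N^-1 * _ = 2^-1 * (z / (al - 1)) + (ln 2 / (al - 1)) / N); last first.
  by field; rewrite gt_eqF // subr_eq0 lt_eqF.
rewrite lerD2l ler_pdivlMr // mulNr lerNl.
apply: (@le_trans _ _ `|ln 2 / (al - 1)|); first by rewrite -normrN ler_norm.
by rewrite [leRHS]mulrC ltW.
Qed.

Lemma upper_rate (al kap e l N : R) : al < 1 -> 0 < e -> 0 < N ->
  l / (1 - al) / e < N ->
  N^-1 * ((N * kap - l) / (al - 1)) <= kap / (al - 1) + e.
Proof.
move=> al1 e0 N0; rewrite ltr_pdivrMr // => H.
rewrite (_ : N^-1 * _ = kap / (al - 1) + (l / (1 - al)) / N); last first.
  by field; rewrite gt_eqF // !subr_eq0 eq_sym lt_eqF.
by rewrite lerD2l ler_pdivrMr // [leRHS]mulrC ltW.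
Qed.

Lemma Dreg_lower d al (A B : 'M[C R]_d) : 0 < al -> al < 1 ->
  density A -> density B -> 0 < rtrpow al (1 - al) A B ->
  ((2^-1 * (ln (rtrpow al (1 - al) A B) / (al - 1)))%:E <= Dtest_reg al A B)%E.
Proof.
move=> al0 al1 dA dB Z0; apply/lee_addgt0Pr => e e0; rewrite -leeBlDr //.
pose M := `|ln 2 / (al - 1)| / e.
apply: (@limn_esup_ge_near _ _ _ (Num.truncn M).+1) => -[//|n] Nn.
have dAn := density_tpow n dA; have dBn := density_tpow n dB.
have := @Dtest_lower _ al (tpow A n.+1) (tpow B n.+1) al0 al1 dAn dBn.
have pA := density_psd dA; have pB := density_psd dB.
rewrite (rtrpow_tpow _ _ _ pA pB) => /(_ (exprn_gt0 _ Z0)) H.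
have n0 : 0 < n.+1%:R^-1 :> R by rewrite invr_gt0.
apply: le_trans (lee_wpmul2l _ H); last by rewrite lee_fin ltW.
rewrite /renyi_of mulr_gt0 ?expR_gt0 // lnM ?posrE ?expR_gt0 // expRK lnXn //.
rewrite -EFinM -EFinB lee_fin; move: (ln (rtrpow _ _ _ _)) => z.
have MN : M < n.+1%:R.
  by apply: lt_le_trans (truncnS_gt M) _; rewrite ler_nat.
by rewrite -[(z *+ _)%R]mulr_natl; exact: lower_rate.
Qed.

Lemma Dreg_orthogonal d al (A B : 'M[C R]_d) : 0 < al -> al < 1 ->
  density A -> density B -> rtrpow al (1 - al) A B = 0 ->
  Dtest_reg al A B = +oo%E.
Proof.
move=> al0 al1 dA dB Z0; apply/eqP; rewrite -leye_eq.
apply: (@limn_esup_ge_near _ _ _ 1%N) => -[//|n] _.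
rewrite Dtest_orthogonal ?gt0_muley ?lte_fin ?invr_gt0 //; try exact: density_tpow.
by rewrite (rtrpow_tpow _ _ _ (density_psd dA) (density_psd dB)) Z0 expr0n.
Qed.

(** For [kap] below the decay exponents of both error powers, every test on [N] copies has a
    two-point sum of at least [expR (N kap) / 16] once [N] is large. *)
Lemma Dreg_upper d al (A B : 'M[C R]_d) mu kap : 0 < al -> al < 1 ->
  density A -> density B -> 0 < rtrpow al (1 - al) A B ->
  (forall e, 0 < e -> exists2 h, 0 < h &
     rtrpow (al + h) (1 - (al + h)) A B < rtrpow al (1 - al) A B * expR (h * mu + h * e) /\
     rtrpow (al - h) (1 - (al - h)) A B < rtrpow al (1 - al) A B * expR (- h * mu + h * e)) ->
  kap <= 0 ->
  kap < al * (ln (rtrpow al (1 - al) A B) + (1 - al) * mu) ->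
  kap < (1 - al) * (ln (rtrpow al (1 - al) A B) - al * mu) ->
  (Dtest_reg al A B <= (kap / (al - 1))%:E)%E.
Proof.
move=> al0 al1 dA dB Z0 Hmu k0; set psi := ln _ => k1 k2.
(* The slack of [kap] below the two exponents. Moving [mu] by [e] changes each exponent by
   [al (1 - al) e], which this slack absorbs. *)
pose e := Num.min (al * (psi + (1 - al) * mu) - kap) ((1 - al) * (psi - al * mu) - kap).
have e0 : 0 < e by rewrite lt_min !subr_gt0 k1.
have [h h0 [Hp Hm]] := Hmu _ e0.
have [N0 HN0] := converse_iid (density_psd dA) (density_psd dB) al0 al1 h0 Z0 Hp Hm.
have al1' : 0 < 1 - al by rewrite subr_gt0.
have ale : al * (1 - al) * e <= e.
  by rewrite ler_piMl ?(ltW e0) // mulr_ile1 // ?(ltW al0) ?(ltW al1) ?(ltW al1') //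
    lerBlDr lerDl ltW.
have ek1 : kap <= al * (psi + (1 - al) * (mu - e)).
  rewrite (_ : al * _ = al * (psi + (1 - al) * mu) - al * (1 - al) * e); last by ring.
  rewrite lerBrDr -lerBrDl; apply: le_trans ale _.
  by rewrite ge_min lexx.
have ek2 : kap <= (1 - al) * (psi - al * (mu + e)).
  rewrite (_ : (1 - al) * _ = (1 - al) * (psi - al * mu) - al * (1 - al) * e); last by ring.
  rewrite lerBrDr -lerBrDl; apply: le_trans ale _.
  by rewrite ge_min lexx orbT.
apply: limn_esup_le_near => d0 d00.
pose M := ln 16 / (1 - al) / d0.
exists (maxn N0.+1 (Num.truncn M).+1) => -[|n]; first by rewrite geq_max ltn0.
rewrite geq_max => /andP[nN0 nM].
have MN : M < n.+1%:R by apply: lt_le_trans (truncnS_gt M) _; rewrite ler_nat.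
have N0' : 0 < n.+1%:R :> R by [].
have H : (Dtest al (tpow A n.+1) (tpow B n.+1) <=
    renyi_of al (expR (n.+1%:R * kap) / 16))%E.
  apply: Dtest_le => T tT; apply: renyi_of_le => //.
  have dAn := density_tpow n dA; have dBn := density_tpow n dB.
  have tT' := test_compl tT.
  (* The converse is used for [T] and for its complement, giving the two weighted bounds of
     [binary_sum_ge]. *)
  have HT := HN0 n nN0 T tT; have HT' := HN0 n nN0 _ tT'.
  have e1E : rtr (tpow A n.+1 *m T) = 1 - rtr (tpow A n.+1 *m (1%:M - T)).
    by rewrite (test_rtrC T dAn) subKr.
  have e2E := test_rtrC T dBn.
  have TT : 1%:M - (1%:M - T) = T by exact: subKr.
  rewrite TT in HT'; rewrite e2E e1E in HT'.
  rewrite /tsum e2E e1E.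
  have ZE : rtrpow al (1 - al) A B ^+ n.+1 = expR (n.+1%:R * psi).
    by rewrite expRM_natl lnK.
  rewrite ZE in HT HT'.
  apply: (binary_sum_ge al0 al1 _ _ _ _ HT HT').
  - exact: test_rtr_ge0.
  - exact: test_rtr_le1.
  - exact: test_rtr_ge0.
  - exact: test_rtr_le1.
  - by rewrite pmulr_rle0.
  - rewrite (_ : al * _ = n.+1%:R * (al * (psi + (1 - al) * (mu - e)))); last by ring.
    by rewrite ler_pM2l.
  - rewrite (_ : (1 - al) * _ = n.+1%:R * ((1 - al) * (psi - al * (mu + e)))); last by ring.
    by rewrite ler_pM2l.
apply: le_trans (lee_wpmul2l _ H) _; first by rewrite lee_fin invr_ge0.
rewrite /renyi_of divr_gt0 ?expR_gt0 // -EFinM -EFinD lee_fin.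
rewrite ln_div ?posrE ?expR_gt0 // expRK.
exact: upper_rate.
Qed.

End TestDivergence.

(** * Equivalence *)

Section Equivalence.
Variable R : realType.
Local Opaque mxpow udiag rtrpow.

Lemma DPetzE n al (A B : 'M[C R]_n) :
  DPetz al A B = renyi_of al (rtrpow al (1 - al) A B).
Proof. by []. Qed.

Lemma DPetz_fin n al (A B : 'M[C R]_n) : 0 < rtrpow al (1 - al) A B ->
  DPetz al A B = (ln (rtrpow al (1 - al) A B) / (al - 1))%:E.
Proof. by move=> Z0; rewrite DPetzE /renyi_of Z0. Qed.

Lemma petz_gt0 n (A B : 'M[C R]_n) s t : density A -> density B ->
  0 < rtrpow s (1 - s) A B -> 0 < rtrpow t (1 - t) A B.
Proof.
move=> /density_psd pA /density_psd pB Zs.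
have [//|Zt] := ltP 0 (rtrpow t (1 - t) A B).
have Zt0 : rtrpow t (1 - t) A B = 0 by apply/le_anti; rewrite Zt (petz_ge0 _ _ pA pB).
by rewrite (petz_eq0 s pA pB Zt0) ltxx in Zs.
Qed.

Lemma mul_expR_le (x y z : R) : 0 < x -> 0 < y ->
  (x * expR z <= y) = (ln x + z <= ln y).
Proof. by move=> x0 y0; rewrite -[RHS]ler_expR expRD !lnK. Qed.

Lemma le_mul_expR (x y z : R) : 0 < x -> 0 < y ->
  (y <= x * expR z) = (ln y <= ln x + z).
Proof. by move=> x0 y0; rewrite -[RHS]ler_expR expRD !lnK. Qed.

Lemma mul_expRE (x z : R) : 0 < x -> x * expR z = expR (ln x + z).
Proof. by move=> x0; rewrite expRD lnK. Qed.

(** Here [p1], [p2] stand for [psi] at [b1], [b2], and [mu] for its slope at [b2]. The tangent at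
    [b2] is at most [p1] at [b1] and at most [0] at [1]; if [p / (b - 1)] does not increase, neither
    inequality has any slack. *)
Lemma renyi_slope_rigid (b1 b2 p1 p2 mu : R) : b1 < b2 -> b2 < 1 ->
  p2 / (b2 - 1) <= p1 / (b1 - 1) -> p2 + (b1 - b2) * mu <= p1 ->
  p2 <= - (1 - b2) * mu ->
  p1 <= p2 + (b1 - b2) * mu /\ p2 = - (1 - b2) * mu.
Proof.
move=> b12 b21; have b11 : b1 < 1 by exact: lt_trans b21.
have eN (p b : R) : b < 1 -> p / (b - 1) = - (p / (1 - b)).
  by move=> b1'; field; rewrite !subr_eq0 eq_sym lt_eqF.
rewrite !eN // lerN2 ler_pdivrMr ?subr_gt0 // mulrAC ler_pdivlMr ?subr_gt0 //.
move=> Dle tan1 B2.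
have d2 : 0 < 1 - b2 by rewrite subr_gt0.
have d12 : 0 < b2 - b1 by rewrite subr_gt0.
split.
  have h := ler_wpM2l (ltW d12) B2; rewrite -(ler_pM2r d2); lra.
apply/le_anti/andP; split=> //.
have h := ler_wpM2r (ltW d2) tan1; rewrite -(ler_pM2l d12); lra.
Qed.

(* A non-increase of the Petz divergence is an equality case of the tangent
   inequality, so the Petz trace is a pure exponential with value [1] at [1]. *)
Lemma petz_exponential n (A B : 'M[C R]_n) b1 b2 : density A -> density B ->
  0 < b1 -> b1 < b2 -> b2 < 1 -> 0 < rtrpow b2 (1 - b2) A B ->
  (DPetz b2 A B <= DPetz b1 A B)%E ->
  exists mu, forall s, rtrpow s (1 - s) A B = expR ((s - 1) * mu).
Proof.
move=> dA dB b10 b12 b21 Z2; have Z1 := @petz_gt0 _ _ _ _ b1 dA dB Z2.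
rewrite (DPetz_fin Z1) (DPetz_fin Z2) lee_fin => Dle.
have [mu [T1 T2 _]] := petz_tangent (density_psd dA) (density_psd dB) Z2.
have b20 : 0 < b2 by exact: lt_trans b12.
have [_ B2] := petz_tangent_bounds dA dB b20 b21 Z2 T1.
have tan1 := T1 b1; rewrite (mul_expR_le _ Z2 Z1) in tan1.
have [le1 mE] := renyi_slope_rigid b12 b21 Dle tan1 B2.
rewrite -(le_mul_expR _ Z2 Z1) in le1.
exists mu => s; rewrite (T2 b1 (negbT (lt_eqF b12)) le1 s) (mul_expRE _ Z2) mE.
by congr expR; ring.
Qed.

(** The support projection of [tpow A n.+1] accepts that state with certainty, so the sum reduces to
    the power [1 - al] of the Petz trace at [0]. For a pure exponential with value [1] at [1], this
    is the Petz trace at [al]. *)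
Lemma saturating_test d al (A B : 'M[C R]_d) mu n : 0 < al -> al < 1 ->
  density A -> density B ->
  (forall s, rtrpow s (1 - s) A B = expR ((s - 1) * mu)) ->
  exists2 T, is_test T &
    tsum al (tpow A n.+1) (tpow B n.+1) T = rtrpow al (1 - al) A B ^+ n.+1.
Proof.
move=> al0 al1 dA dB ZE; have dAn := density_tpow n dA; have dBn := density_tpow n dB.
have tT := mxpow0_test (density_psd dAn).
exists (mxpow (tpow A n.+1) 0) => //; rewrite /tsum.
rewrite (test_rtrC _ dAn) (mxpow0_idl (density_psd dAn)) (density_rtr dAn) subrr.
rewrite powR1 mul1r powR0 ?gt_eqF // mul0r addr0.
have -> : rtr (tpow B n.+1 *m mxpow (tpow A n.+1) 0) = rtrpow 0 1 (tpow A n.+1) (tpow B n.+1).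
  by rewrite rtrpowC -{1}(mxpow1 (density_psd dBn)).
rewrite (rtrpow_tpow _ _ _ (density_psd dA) (density_psd dB)) ZE.
have := ZE 0; have -> : 1 - 0 = 1 :> R by exact: subr0.
move=> ->; rewrite -!expRM_natl -expRM; congr expR; ring.
Qed.

Lemma Dtest_ge_DPetz d n al (A B : 'M[C R]_d) (T : 'M[C R]_(d ^ n.+1)) : 0 < al -> al < 1 ->
  density A -> density B -> is_test T ->
  tsum al (tpow A n.+1) (tpow B n.+1) T = rtrpow al (1 - al) A B ^+ n.+1 ->
  (DPetz al A B <= (n.+1%:R^-1)%:E * Dtest al (tpow A n.+1) (tpow B n.+1))%E.
Proof.
move=> al0 al1 dA dB tT TE.
rewrite DPetzE -(renyi_of_expn al n (petz_ge0 _ _ (density_psd dA) (density_psd dB))).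
apply: lee_wpmul2l; first by rewrite lee_fin invr_ge0.
rewrite -TE; exact: Dtest_ge.
Qed.

(** By contraposition: a failure of strict increase yields a saturating test, on every number of
    copies. The second divergence is treated by exchanging [A] with [B] and [al] with [1 - al]. *)
Lemma DPetz_increasing d al (A B : 'M[C R]_d) n : 0 < al -> al < 1 ->
  density A -> density B ->
  ((n.+1%:R^-1)%:E * Dtest al (tpow A n.+1) (tpow B n.+1) < DPetz al A B)%E ->
  (forall b1 b2 : R, 0 < b1 -> b1 < b2 -> b2 < 1 -> (DPetz b1 A B < DPetz b2 A B)%E) /\
  (forall b1 b2 : R, 0 < b1 -> b1 < b2 -> b2 < 1 -> (DPetz b1 B A < DPetz b2 B A)%E).
Proof.
move=> al0 al1 dA dB lt.
have al0' : 0 < 1 - al by rewrite subr_gt0.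
have al1' : 1 - al < 1 by rewrite ltrBlDr ltrDl.
have pA := density_psd dA; have pB := density_psd dB.
have Z0 : 0 < rtrpow al (1 - al) A B.
  have [//|Z0] := ltP 0 (rtrpow al (1 - al) A B).
  have {}Z0 : rtrpow al (1 - al) A B = 0.
    by apply/le_anti; rewrite Z0 (petz_ge0 _ _ pA pB).
  move: lt.
  rewrite (Dtest_orthogonal al0 al1 (density_tpow n dA) (density_tpow n dB)).
    by rewrite gt0_muley ?lte_fin ?invr_gt0 // ltNge leey.
  by rewrite (rtrpow_tpow _ _ _ pA pB) Z0 expr0n.
have swapZ s : rtrpow s (1 - s) B A = rtrpow (1 - s) (1 - (1 - s)) A B.
  by rewrite subKr; exact: rtrpowC.
split=> b1 b2 b10 b12 b21; rewrite ltNge; apply/negP => Dle.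
  have [mu ZE] := petz_exponential dA dB b10 b12 b21 (petz_gt0 b2 dA dB Z0) Dle.
  have [T tT TE] := saturating_test n al0 al1 dA dB ZE.
  by have := Dtest_ge_DPetz al0 al1 dA dB tT TE; rewrite leNgt lt.
have Z2 : 0 < rtrpow b2 (1 - b2) B A by rewrite swapZ; exact: petz_gt0 dA dB Z0.
have [mu ZE] := petz_exponential dB dA b10 b12 b21 Z2 Dle.
have [T tT TE] := saturating_test n al0' al1' dB dA ZE.
rewrite -tsum_swap swapZ subKr in TE.
by have := Dtest_ge_DPetz al0 al1 dA dB tT TE; rewrite leNgt lt.
Qed.

Lemma Dreg_le_DPetz d al (A B : 'M[C R]_d) : 0 < al -> al < 1 ->
  density A -> density B -> (Dtest_reg al A B <= DPetz al A B)%E.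
Proof.
move=> al0 al1 dA dB; have pA := density_psd dA; have pB := density_psd dB.
have [Z0|Z0] := ltP 0 (rtrpow al (1 - al) A B); last first.
  by rewrite DPetzE /renyi_of ltNge Z0 leey.
have [mu [T1 _ T3]] := petz_tangent pA pB Z0.
have [B1 B2] := petz_tangent_bounds dA dB al0 al1 Z0 T1.
rewrite (DPetz_fin Z0); apply/lee_addgt0Pr => e e0; rewrite -EFinD.
move: B1 B2 (fun k => @Dreg_upper _ _ al A B mu k al0 al1 dA dB Z0 T3).
move: (ln _) => psi B1 B2 H.
have al0' : 0 < 1 - al by rewrite subr_gt0.
have h1 := mulr_gt0 al0' e0.
(* The tangent bounds put [0] and both exponents of [Dreg_upper] at or above [psi], so [kap] can be
   taken just below [psi]. *)
have -> : psi / (al - 1) + e = (psi - (1 - al) * e) / (al - 1).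
  by field; rewrite subr_eq0 lt_eqF.
by apply: H; nra.
Qed.

Lemma tilt_exponent_gap (al psi pt pr mu : R) : 0 < al -> al < 1 ->
  psi / (al - 1) < pt / ((1 + al) / 2 - 1) -> psi / - al < pr / - (al / 2) ->
  psi + ((1 + al) / 2 - al) * mu <= pt -> psi + (al / 2 - al) * mu <= pr ->
  exists kap, [/\ kap <= 0, kap < al * (psi + (1 - al) * mu),
    kap < (1 - al) * (psi - al * mu) & psi < kap].
Proof.
move=> al0 al1; have al0' : 0 < 1 - al by rewrite subr_gt0.
have -> : psi / (al - 1) = - psi / (1 - al).
  by field; rewrite !subr_eq0 eq_sym lt_eqF.
have -> : pt / ((1 + al) / 2 - 1) = - (2 * pt) / (1 - al).
  by field; apply/andP; split; lra.
rewrite ltr_pM2r ?invr_gt0 // ltrN2 => D1.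
have -> : psi / - al = - psi / al by field; rewrite gt_eqF.
have -> : pr / - (al / 2) = - (2 * pr) / al by field; rewrite gt_eqF.
rewrite ltr_pM2r ?invr_gt0 // ltrN2 => D2 tt tr.
have m1 : psi < al * mu by lra.
have m2 : psi < - (1 - al) * mu by lra.
have psi0 : psi < 0.
  have [m0|m0] := leP 0 mu; nra.
have k1 : psi < al * (psi + (1 - al) * mu) by nra.
have k2 : psi < (1 - al) * (psi - al * mu) by nra.
pose m := Num.min 0 (Num.min (al * (psi + (1 - al) * mu)) ((1 - al) * (psi - al * mu))).
have pm : psi < m by rewrite !lt_min psi0 k1.
have m00 : m <= 0 by rewrite ge_min lexx.
have m01 : m <= al * (psi + (1 - al) * mu) by rewrite !ge_min lexx orbT.
have m02 : m <= (1 - al) * (psi - al * mu) by rewrite !ge_min lexx !orbT.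
exists ((psi + m) / 2); split; lra.
Qed.

Lemma Dreg_lt_DPetz d al (A B : 'M[C R]_d) : 0 < al -> al < 1 ->
  density A -> density B ->
  (forall b1 b2 : R, 0 < b1 -> b1 < b2 -> b2 < 1 -> (DPetz b1 A B < DPetz b2 A B)%E) ->
  (forall b1 b2 : R, 0 < b1 -> b1 < b2 -> b2 < 1 -> (DPetz b1 B A < DPetz b2 B A)%E) ->
  (Dtest_reg al A B < DPetz al A B)%E.
Proof.
move=> al0 al1 dA dB incA incB; have pA := density_psd dA; have pB := density_psd dB.
pose t := (1 + al) / 2; pose r := al / 2.
have [at1 t1] : al < t /\ t < 1 by rewrite /t; split; lra.
have [r0 ra] : 0 < r /\ r < al by rewrite /r; split; lra.
(* An infinite divergence at [al] could not be exceeded at [t]. *)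
have Z0 : 0 < rtrpow al (1 - al) A B.
  have := incA al t al0 at1 t1; rewrite DPetzE /renyi_of; case: ifP => // _.
  by rewrite ltNge leey.
have Zt := petz_gt0 t dA dB Z0; have Zr := petz_gt0 r dA dB Z0.
have [mu [T1 _ T3]] := petz_tangent pA pB Z0.
have swapD s : 0 < rtrpow s (1 - s) A B ->
    DPetz (1 - s) B A = (ln (rtrpow s (1 - s) A B) / - s)%:E.
  move=> Zs; have E : rtrpow (1 - s) (1 - (1 - s)) B A = rtrpow s (1 - s) A B.
    by rewrite subKr; exact: rtrpowC.
  have Zs' : 0 < rtrpow (1 - s) (1 - (1 - s)) B A by rewrite E.
  have e : 1 - s - 1 = - s by rewrite addrAC subrr add0r.
  by rewrite (DPetz_fin Zs') E e.
have D1 := incA al t al0 at1 t1; rewrite (DPetz_fin Z0) (DPetz_fin Zt) lte_fin in D1.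
have D2 : (DPetz (1 - al) B A < DPetz (1 - r) B A)%E.
  by apply: incB; rewrite ?subr_gt0 // ?ltrD2l ?ltrN2 // ltrBlDr ltrDl.
rewrite (swapD _ Z0) (swapD _ Zr) lte_fin in D2.
have tt := T1 t; rewrite (mul_expR_le _ Z0 Zt) in tt.
have tr := T1 r; rewrite (mul_expR_le _ Z0 Zr) in tr.
have [kap [k0 k1 k2 k3]] := tilt_exponent_gap al0 al1 D1 D2 tt tr.
rewrite (DPetz_fin Z0); apply: le_lt_trans (Dreg_upper al0 al1 dA dB Z0 T3 k0 k1 k2) _.
by rewrite lte_fin ltr_nM2r // invr_lt0 subr_lt0.
Qed.

End Equivalence.

Theorem mainTheorem2 (R : realType) (d : nat) (rho sigma : 'M[C R]_d) :
  density rho -> density sigma ->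
  (forall alpha : R, 0 < alpha < 1 ->
     ((2^-1)%:E * DPetz alpha rho sigma <= Dtest_reg alpha rho sigma)%E /\
     (Dtest_reg alpha rho sigma <= DPetz alpha rho sigma)%E) /\
  let P1 := forall alpha : R, 0 < alpha < 1 ->
              (Dtest_reg alpha rho sigma < DPetz alpha rho sigma)%E in
  let P2 := exists2 alpha : R, 0 < alpha < 1 &
              (Dtest_reg alpha rho sigma < DPetz alpha rho sigma)%E in
  let P3 := exists alpha : R, exists n : nat, [/\ 0 < alpha < 1, (0 < n)%N &
              (((n%:R)^-1)%:E * Dtest alpha (tpow rho n) (tpow sigma n)
                 < DPetz alpha rho sigma)%E] in
  let P4 := (forall b1 b2 : R, 0 < b1 -> b1 < b2 -> b2 < 1 ->
               (DPetz b1 rho sigma < DPetz b2 rho sigma)%E) /\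
            (forall b1 b2 : R, 0 < b1 -> b1 < b2 -> b2 < 1 ->
               (DPetz b1 sigma rho < DPetz b2 sigma rho)%E) in
  (P1 <-> P2) /\ (P1 <-> P3) /\ (P1 <-> P4).
Proof.
move=> drho dsigma; split=> [al /andP[al0 al1]|P1 P2 P3 P4].
  split; last exact: Dreg_le_DPetz.
  have [Z0|Z0] := ltP 0 (rtrpow al (1 - al) rho sigma).
    by rewrite (DPetz_fin Z0); exact: Dreg_lower.
  rewrite Dreg_orthogonal ?leey //; apply/le_anti.
  by rewrite Z0 (petz_ge0 _ _ (density_psd drho) (density_psd dsigma)).
(* The equivalences follow from the cycle [P1], [P2], [P3], [P4], [P1]. For [P3] from [P2]: if no
   [n >= 1] gave a strict inequality, neither would the limit superior. *)
have P12 : P1 -> P2.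
  by move=> H; exists 2^-1; [|apply: H]; apply/andP; split; lra.
have P23 : P2 -> P3.
  move=> [al al01 H]; exists al; apply: contrapT => no; move: H; rewrite ltNge => /negP; apply.
  apply: (@limn_esup_ge_near _ _ _ 1%N) => n n0; rewrite leNgt; apply/negP => lt.
  by apply: no; exists n.
have P34 : P3 -> P4.
  by move=> [al [[|n] [/andP[al0 al1] // _ lt]]]; exact: DPetz_increasing al0 al1 drho dsigma lt.
have P41 : P4 -> P1.
  by move=> [incA incB] al /andP[al0 al1]; exact: Dreg_lt_DPetz.
split; first by split=> // p2; exact/P41/P34/P23.
split; first by split=> [p1|p3]; [exact/P23/P12|exact/P41/P34].
by split=> // p1; exact/P34/P23/P12.
Qed.
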